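(* Let $w\in\mathbb{R}$ with $w>0$, let $b\in\mathbb{C}$, let $\sigma\in\mathbb{R}$ with $0<\sigma<\Re(b)$, and let $a\in\mathbb{C}\setminus\{0\}$ with $-\pi<\arg(a)<\pi$. Then $$\frac{1}{2\pi i\,\Gamma(b+1)}\int_{\sigma-i\infty}^{\sigma+i\infty}a^{-v}\,\Gamma(v)\,\Gamma(b+1-v)\,\zeta\!\left(b+1-v,\,w+\tfrac12\right)dv=\zeta\!\left(b+1,\,a+w+\tfrac12\right).$$
   Context: $\zeta(s,a)$ is the Hurwitz zeta function, $\zeta(s,a)=\sum_{k=0}^{\infty}1/(k+a)^s$ for $\Re(s)>1$. Powers of complex numbers are taken with the principal branch; integration is along the vertical line $\Re(v)=\sigma$. *)

(* Defs.v *)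
(* Stdlib world: concrete reals R, with Coquelicot's complex numbers,
   generalized Riemann integrals and series. *)
From Stdlib Require Import Reals.
From Coquelicot Require Import Coquelicot.

Open Scope R_scope.

Definition Cexp (z : C) : C :=
  (exp (Re z) * cos (Im z), exp (Re z) * sin (Im z)).

(* Principal argument, with values in (-PI, PI]; the negative real axis is sent
   to PI.  The value at 0 is irrelevant. *)
Definition Carg (z : C) : R :=
  if Rle_dec 0 (Im z) then acos (Re z / Cmod z) else - acos (Re z / Cmod z).

Definition Clog (z : C) : C := (ln (Cmod z), Carg z).

(* Principal branch of z ^ s, for z <> 0.  Coquelicot's own Cpow only has
   exponents in nat. *)
Definition Cpower (z s : C) : C := Cexp (Cmult s (Clog z)).

(* Euler's integral of the second kind, improper at both 0 and infinity.  It is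
   the Gamma function on the half-plane 0 < Re z, where it converges; elsewhere
   the value is unspecified. *)
Definition CGamma (z : C) : C :=
  RInt_gen (V := C_R_CompleteNormedModule)
    (fun t : R => Cmult (Cpower (RtoC t) (Cminus z 1)) (RtoC (exp (- t))))
    (at_right 0) (Rbar_locally p_infty).

(* Sum of a complex series, by components: Coquelicot's total operator Series is
   only available for real terms. *)
Definition CSeries (u : nat -> C) : C :=
  (Series (fun k => Re (u k)), Series (fun k => Im (u k))).

(* The Dirichlet-type series, meaningful for 1 < Re s; the analytic continuation
   in s is not part of this definition. *)
Definition hurwitz_zeta (s a : C) : C :=
  CSeries (fun k => Cdiv 1 (Cpower (Cplus (RtoC (INR k)) a) s)).

(* Integrals along Re v = sigma, upwards, with the parametrization
   v = sigma + i t, dv = i dt; both ends are independent improper limits. *)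
Definition ex_vertical_integral (f : C -> C) (sigma : R) : Prop :=
  ex_RInt_gen (V := C_R_NormedModule)
    (fun t : R => Cmult (f (sigma, t)) Ci)
    (Rbar_locally m_infty) (Rbar_locally p_infty).

Definition vertical_integral (f : C -> C) (sigma : R) : C :=
  RInt_gen (V := C_R_CompleteNormedModule)
    (fun t : R => Cmult (f (sigma, t)) Ci)
    (Rbar_locally m_infty) (Rbar_locally p_infty).

Definition mellin_barnes_integrand (a b : C) (w : R) (v : C) : C :=
  (Cpower a (- v) * CGamma v * CGamma (b + 1 - v)
     * hurwitz_zeta (b + 1 - v) (RtoC (w + 1 / 2)))%C.

(* Main.v *)
Require Import Defs.
From Stdlib Require Import Reals Lra Lia FunctionalExtensionality.
From Coquelicot Require Import Coquelicot.
Open Scope R_scope.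

(* Substituting [t = exp u], the Gamma integral becomes the integral over the real line of
   [exp (v z - exp z)]; moving the line to [R + zeta], [|Im zeta| < pi/2], gives
   [int exp (v u - exp (u + zeta)) du = exp (- v zeta) Gamma(v)], hence also the exponential decay of
   [Gamma] on vertical lines.  Read as a Fourier transform in [Im v], this is inverted by Abel
   summation: [exp (- z)] is the inverse Mellin transform of [Gamma].  Inserting this in
   [int t^(s-1) exp (- (z1 + z2) t) dt] and exchanging the integrals gives the Mellin-Barnes integral
   of [Gamma(v) Gamma(s-v) z1^(-v) z2^(v-s)] for [z1], [z2] in the right half-plane.  For
   [|arg a| < pi] and [c > 0], rotating both [a] and [c] by [- arg a / 2] reduces to that case.
   Finally one sums over [c = k + w + 1/2]. *)

Set Bullet Behavior "Strict Subproofs".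

(** Every limit is made quantitative by one majorant, [M / (1 + u ^ 2)]. Its primitive is
    [M * atan], so tails are bounded explicitly and uniformly in parameters, and each exchange of
    integrals becomes Fubini on a square plus an error proportional to [PI - 2 * atan N]. The angle
    of the rotation is forced by symmetry: [c] lies on the positive axis while [|arg a|] may
    approach pi, and turning both by [- arg a / 2] leaves them at [arg a / 2] and [- arg a / 2]. The
    integrand is homogeneous of degree [- s] in [(z1, z2)], so both sides acquire the same factor.
    Dividing by [Gamma(b + 1)] is an obstacle of its own: the factor has to be cancelled, so Gamma
    must be shown not to vanish for positive real part. An estimate for large real part, carried to
    the left by the functional equation, does this. In the last summation the terms have modulus
    [c ^ (sigma - Re b - 1)] on the line of integration; [sigma < Re b] is exactly the condition for
    their sum to converge, and then it converges uniformly. *)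

(** * Continuity and integrals of complex functions of a real variable *)

Definition Ccont (f : R -> C) : Prop :=
  forall x : R, continuous (fun t => Re (f t)) x /\ continuous (fun t => Im (f t)) x.

(** Taken by components so that results on the real [RInt] apply directly; [CInt_correct] and
    [CInt_unique] link it to integration in [C_R_NormedModule]. *)
Definition CInt (f : R -> C) (a b : R) : C :=
  (RInt (fun t => Re (f t)) a b, RInt (fun t => Im (f t)) a b).

Lemma C_eq (z1 z2 : C) : Re z1 = Re z2 -> Im z1 = Im z2 -> z1 = z2.
Proof. destruct z1, z2; simpl; congruence. Qed.

Lemma Re_le_Cmod (z : C) : Re z <= Cmod z.
Proof. generalize (re_le_Cmod z), (Rle_abs (Re z)); lra. Qed.

Lemma Cmod_le_Re_Im (z : C) : Cmod z <= Rabs (Re z) + Rabs (Im z).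
Proof.
  replace z with (Re z + Im z * Ci)%C
    by (apply C_eq; simpl; ring).
  eapply Rle_trans; [apply Cmod_triangle|].
  rewrite Cmod_mult, !Cmod_R, Cmod_Ci.
  simpl. apply Req_le. f_equal; [f_equal; ring|rewrite Rmult_1_r; f_equal; ring].
Qed.

Lemma Ccont_continuous (f : R -> C) (x : R) :
  Ccont f -> continuous (U := C_R_NormedModule) f x.
Proof.
  intros H; destruct (H x) as [H1 H2].
  apply filterlim_locally; intros eps.
  generalize (filter_and _ _ (proj1 (filterlim_locally _ _) H1 eps)
    (proj1 (filterlim_locally _ _) H2 eps)).
  apply filter_imp; intros y [Hy1 Hy2]; split; assumption.
Qed.

Lemma Ccont_of_continuous (f : R -> C) :
  (forall x, continuous (U := C_R_NormedModule) f x) -> Ccont f.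
Proof.
  intros H x; split.
  - apply (continuous_comp (V := C_R_NormedModule) f Re); [apply H|].
    apply (continuous_fst (U := R_UniformSpace) (V := R_UniformSpace)).
  - apply (continuous_comp (V := C_R_NormedModule) f Im); [apply H|].
    apply (continuous_snd (U := R_UniformSpace) (V := R_UniformSpace)).
Qed.

Lemma Ccont_const (c : C) : Ccont (fun _ => c).
Proof. intros x; split; apply continuous_const. Qed.

Lemma Ccont_plus (f g : R -> C) :
  Ccont f -> Ccont g -> Ccont (fun x => f x + g x)%C.
Proof.
  intros Hf Hg x; destruct (Hf x), (Hg x); split; simpl;
    apply (continuous_plus (V := R_NormedModule)); assumption.
Qed.

Lemma Ccont_mult (f g : R -> C) :
  Ccont f -> Ccont g -> Ccont (fun x => f x * g x)%C.
Proof.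
  intros Hf Hg x; destruct (Hf x), (Hg x); split; simpl.
  - apply (continuous_minus (V := R_NormedModule));
      apply (continuous_mult (K := R_AbsRing)); assumption.
  - apply (continuous_plus (V := R_NormedModule));
      apply (continuous_mult (K := R_AbsRing)); assumption.
Qed.

Lemma Ccont_opp (f : R -> C) : Ccont f -> Ccont (fun x => - f x)%C.
Proof.
  intros Hf x; destruct (Hf x); split; simpl;
    apply (continuous_opp (V := R_NormedModule)); assumption.
Qed.

Lemma Ccont_minus (f g : R -> C) :
  Ccont f -> Ccont g -> Ccont (fun x => f x - g x)%C.
Proof. intros; apply Ccont_plus; [|apply Ccont_opp]; assumption. Qed.

Lemma Ccont_ext (f g : R -> C) : (forall x, f x = g x) -> Ccont f -> Ccont g.
Proof.
  intros E H x; destruct (H x); split.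
  - eapply continuous_ext; [intros t; rewrite <- E; reflexivity|assumption].
  - eapply continuous_ext; [intros t; rewrite <- E; reflexivity|assumption].
Qed.

Lemma Ccont_RtoC (f : R -> R) : (forall x, continuous f x) -> Ccont (fun x => RtoC (f x)).
Proof. intros Hf x; split; simpl; [apply Hf|apply continuous_const]. Qed.

Lemma ex_RInt_cont (f : R -> R) (a b : R) :
  (forall x, continuous f x) -> ex_RInt f a b.
Proof. intros H; apply (ex_RInt_continuous (V := R_CompleteNormedModule)); auto. Qed.

Lemma ex_RInt_Re (f : R -> C) (a b : R) : Ccont f -> ex_RInt (fun t => Re (f t)) a b.
Proof. intros H; apply ex_RInt_cont; intros x; exact (proj1 (H x)). Qed.

Lemma ex_RInt_Im (f : R -> C) (a b : R) : Ccont f -> ex_RInt (fun t => Im (f t)) a b.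
Proof. intros H; apply ex_RInt_cont; intros x; exact (proj2 (H x)). Qed.

Lemma CInt_correct (f : R -> C) (a b : R) :
  Ccont f -> is_RInt (V := C_R_NormedModule) f a b (CInt f a b).
Proof.
  intros H.
  apply (is_RInt_fct_extend_pair (U := R_NormedModule) (V := R_NormedModule)).
  - apply (RInt_correct (V := R_CompleteNormedModule)), (ex_RInt_Re f a b H).
  - apply (RInt_correct (V := R_CompleteNormedModule)), (ex_RInt_Im f a b H).
Qed.

Lemma CInt_unique (f : R -> C) (a b : R) (l : C) :
  is_RInt (V := C_R_NormedModule) f a b l -> CInt f a b = l.
Proof.
  intros H. apply C_eq; simpl; apply is_RInt_unique.
  - apply (is_RInt_fct_extend_fst (U := R_NormedModule) (V := R_NormedModule)), H.
  - apply (is_RInt_fct_extend_snd (U := R_NormedModule) (V := R_NormedModule)), H.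
Qed.

Lemma CInt_ext (f g : R -> C) (a b : R) :
  (forall x, f x = g x) -> CInt f a b = CInt g a b.
Proof.
  intros H; unfold CInt; f_equal; apply RInt_ext; intros; rewrite H; reflexivity.
Qed.

(** The scalars of [C_R_NormedModule] are real, so for a complex [c] linearity is applied to the two
    components, which [c] mixes. *)
Lemma CInt_scal (c : C) (f : R -> C) (a b : R) :
  Ccont f -> CInt (fun x => c * f x)%C a b = (c * CInt f a b)%C.
Proof.
  intros Hf.
  assert (H : forall (k l : R) (u v : R -> R),
    (forall x, continuous u x) -> (forall x, continuous v x) ->
    RInt (fun x => k * u x + l * v x) a b = k * RInt u a b + l * RInt v a b).
  { intros k l u v Hu Hv.
    apply is_RInt_unique.
    apply (is_RInt_plus (V := R_NormedModule) (fun x => k * u x) (fun x => l * v x));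
      apply (is_RInt_scal (V := R_NormedModule));
      apply (RInt_correct (V := R_CompleteNormedModule)), ex_RInt_cont; assumption. }
  assert (H1 : forall x, continuous (fun t => Re (f t)) x) by (intros x; exact (proj1 (Hf x))).
  assert (H2 : forall x, continuous (fun t => Im (f t)) x) by (intros x; exact (proj2 (Hf x))).
  apply C_eq; simpl.
  - rewrite <- (RInt_ext (fun x => Re c * Re (f x) + (- Im c) * Im (f x))).
    + rewrite H by assumption. unfold Re, Im, CInt; simpl.
      match goal with |- ?u = ?v => change (@eq R u v) end. ring.
    + intros; unfold Re, Im; simpl.
      match goal with |- ?u = ?v => change (@eq R u v) end. ring.
  - rewrite <- (H (fst c) (snd c)) by assumption. reflexivity.
Qed.

Lemma CInt_minus (f g : R -> C) (a b : R) :
  Ccont f -> Ccont g ->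
  CInt (fun x => f x - g x)%C a b = (CInt f a b - CInt g a b)%C.
Proof.
  intros Hf Hg; apply CInt_unique.
  exact (is_RInt_minus (V := C_R_NormedModule) f g a b _ _
    (CInt_correct f a b Hf) (CInt_correct g a b Hg)).
Qed.

Lemma CInt_Chasles (f : R -> C) (a b c : R) :
  Ccont f -> (CInt f a b + CInt f b c)%C = CInt f a c.
Proof.
  intros Hf; symmetry; apply CInt_unique.
  exact (is_RInt_Chasles (V := C_R_NormedModule) f a b c _ _
    (CInt_correct f a b Hf) (CInt_correct f b c Hf)).
Qed.

Lemma CInt_le (f : R -> C) (g : R -> R) (a b : R) (lg : R) :
  a <= b -> Ccont f -> is_RInt g a b lg ->
  (forall x, a <= x <= b -> Cmod (f x) <= g x) -> Cmod (CInt f a b) <= lg.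
Proof.
  intros Hab Hf Hg H.
  rewrite Cmod_norm.
  apply (norm_RInt_le (V := C_R_NormedModule) f g a b); auto.
  - intros x Hx; specialize (H x Hx). rewrite Cmod_norm in H. exact H.
  - apply CInt_correct, Hf.
Qed.

Lemma CInt_le_const (f : R -> C) (a b c : R) :
  a <= b -> Ccont f -> (forall x, a <= x <= b -> Cmod (f x) <= c) ->
  Cmod (CInt f a b) <= (b - a) * c.
Proof.
  intros Hab Hf H. apply (CInt_le f (fun _ => c) a b); auto.
  exact (is_RInt_const (V := R_NormedModule) a b c).
Qed.

Lemma CInt_derive (f df : R -> C) (a b : R) :
  (forall x, is_derive (fun t => Re (f t)) x (Re (df x))) ->
  (forall x, is_derive (fun t => Im (f t)) x (Im (df x))) ->
  Ccont df -> CInt df a b = (f b - f a)%C.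
Proof.
  intros H1 H2 Hc.
  apply C_eq; simpl; apply is_RInt_unique.
  - apply (is_RInt_derive (V := R_CompleteNormedModule) (fun t => Re (f t)));
      intros x _; [apply H1|exact (proj1 (Hc x))].
  - apply (is_RInt_derive (V := R_CompleteNormedModule) (fun t => Im (f t)));
      intros x _; [apply H2|exact (proj2 (Hc x))].
Qed.

(** * Fubini's theorem on rectangles *)

(** On the compact segment of [y] the continuity in [x] is uniform, so nearby integrands differ by a
    small constant. The case [d < c] follows by changing the sign. *)
Lemma RInt_param_continuous (f : R -> R -> R) (c d x : R) :
  (forall x y : R, continuity_2d_pt f x y) ->
  continuous (fun x : R => RInt (fun y : R => f x y) c d) x.
Proof.
  intros Hf.
  assert (Hc : forall x y : R, continuous (fun t : R => f x t) y).
  { intros x0 y0. apply continuity_pt_filterlim.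
    intros eps Heps. destruct (Hf x0 y0 (mkposreal eps Heps)) as [del Hd].
    exists del; split; [apply del|]. intros z [_ Hz].
    apply Hd; [rewrite Rminus_diag, Rabs_R0; apply del|exact Hz]. }
  assert (Hle : forall c d : R, c <= d -> continuous (fun x : R => RInt (fun y : R => f x y) c d) x).
  { clear c d; intros c d Hcd.
    apply filterlim_locally; intros eps.
    (* The [+ 1] keeps the denominator positive when [c = d]. *)
    assert (He : 0 < eps / (2 * (d - c + 1))).
    { apply Rdiv_lt_0_compat; [apply eps|lra]. }
    destruct (uniform_continuity_2d_1d' f c d x (fun y _ => Hf x y) (mkposreal _ He)) as [del Hd].
    exists del; intros x' Hx'. change (Rabs (x' - x) < del) in Hx'.
    change (Rabs (RInt (fun y => f x' y) c d - RInt (fun y => f x y) c d) < eps).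
    rewrite <- (RInt_minus (V := R_CompleteNormedModule)) by (apply ex_RInt_cont; apply Hc).
    apply Rle_lt_trans with ((d - c) * (eps / (2 * (d - c + 1)))).
    - apply (norm_RInt_le_const (V := R_NormedModule) (fun y => minus (f x' y) (f x y)) c d).
      + assumption.
      + intros y Hy. simpl in Hd.
        assert (Hdel : 0 < del) by apply del.
        apply Rlt_le. apply Rabs_def2 in Hx'.
        apply (Hd y x y x'); try (split; lra).
        rewrite Rminus_diag, Rabs_R0. apply del.
      + apply (RInt_correct (V := R_CompleteNormedModule)). apply ex_RInt_cont.
        intros y; apply (continuous_minus (V := R_NormedModule)); apply Hc.
    - assert (0 < eps) by apply eps.
      apply Rmult_lt_reg_r with (2 * (d - c + 1)); [lra|].
      replace ((d - c) * (eps / (2 * (d - c + 1))) * (2 * (d - c + 1)))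
        with ((d - c) * eps) by (field; lra). nra. }
  destruct (Rle_dec c d) as [H|H]; [auto|].
  apply continuous_ext with (fun x => - RInt (fun y => f x y) d c).
  - intros t. apply (opp_RInt_swap (V := R_CompleteNormedModule)). apply ex_RInt_cont; apply Hc.
  - apply (continuous_opp (V := R_NormedModule)). apply Hle; lra.
Qed.

Lemma continuity_2d_sections (f : R -> R -> R) :
  (forall x y : R, continuity_2d_pt f x y) ->
  (forall x y : R, continuous (fun t => f x t) y) /\ (forall x y : R, continuous (fun t => f t x) y).
Proof.
  intros Hf; split; intros x0 y0; apply continuity_pt_filterlim; intros eps Heps.
  - destruct (Hf x0 y0 (mkposreal eps Heps)) as [del Hd].
    exists del; split; [apply del|]. intros z [_ Hz].
    apply Hd; [rewrite Rminus_diag, Rabs_R0; apply del|exact Hz].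
  - destruct (Hf y0 x0 (mkposreal eps Heps)) as [del Hd].
    exists del; split; [apply del|]. intros z [_ Hz].
    apply Hd; [exact Hz|rewrite Rminus_diag, Rabs_R0; apply del].
Qed.

Lemma continuity_2d_swap (f : R -> R -> R) (x y : R) :
  continuity_2d_pt f x y -> continuity_2d_pt (fun u v => f v u) y x.
Proof.
  intros H eps. destruct (H eps) as [del Hd]. exists del.
  intros u v Hu Hv. apply Hd; assumption.
Qed.

Lemma RInt_param_continuous' (f : R -> R -> R) (a b y : R) :
  (forall x y : R, continuity_2d_pt f x y) ->
  continuous (fun y => RInt (fun x => f x y) a b) y.
Proof.
  intros Hf. apply (RInt_param_continuous (fun u v => f v u)).
  intros; apply continuity_2d_swap, Hf.
Qed.

(* Both sides vanish for [b = a] and have the same derivative in [b]. *)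
Lemma RInt_swap_order (f : R -> R -> R) (a b c d : R) :
  (forall x y : R, continuity_2d_pt f x y) ->
  RInt (fun x : R => RInt (fun y : R => f x y) c d) a b =
  RInt (fun y => RInt (fun x => f x y) a b) c d.
Proof.
  intros Hf.
  destruct (continuity_2d_sections f Hf) as [Hc1 Hc2].
  set (D := fun x => RInt (fun x : R => RInt (fun y : R => f x y) c d) a x -
    RInt (fun y => RInt (fun s => f s y) a x) c d).
  assert (Hder : forall (x y : R), is_derive (fun z => RInt (fun s => f s y) a z) x (f x y)).
  { intros x y. apply (is_derive_RInt (V := R_NormedModule) (fun s => f s y)
      (fun z => RInt (fun s => f s y) a z) a).
    - apply filter_forall; intros z.
      apply (RInt_correct (V := R_CompleteNormedModule)), ex_RInt_cont; apply Hc2.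
    - apply Hc2. }
  assert (HD : forall x, is_derive D x zero).
  { intros x. unfold D.
    replace (@zero R_NormedModule) with (RInt (fun y => f x y) c d - RInt (fun y => f x y) c d)
      by (rewrite Rminus_diag; reflexivity).
    apply (is_derive_minus (V := R_NormedModule)).
    - apply (is_derive_RInt (V := R_NormedModule) (fun s => RInt (fun y => f s y) c d)
        (fun z => RInt (fun s => RInt (fun y => f s y) c d) a z) a).
      + apply filter_forall; intros z.
        apply (RInt_correct (V := R_CompleteNormedModule)), ex_RInt_cont.
        intros; apply RInt_param_continuous; assumption.
      + apply RInt_param_continuous; assumption.
    - replace (RInt (fun y => f x y) c d) with
        (RInt (fun t => Derive (fun z => RInt (fun s => f s t) a z) x) c d)
        by (apply RInt_ext; intros; apply is_derive_unique, Hder).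
      apply (is_derive_RInt_param (fun z t => RInt (fun s => f s t) a z) c d x).
      + apply filter_forall; intros z t _. eexists; apply Hder.
      + intros t _. apply continuity_2d_pt_ext with f; [|apply Hf].
        intros; symmetry; apply is_derive_unique, Hder.
      + apply filter_forall; intros z. apply ex_RInt_cont.
        intros; apply RInt_param_continuous'; assumption. }
  assert (H : D a = D b).
  { destruct (Rtotal_order a b) as [H|[H|H]].
    - apply (eq_is_derive (V := R_NormedModule) D a b); auto.
    - subst; reflexivity.
    - symmetry; apply (eq_is_derive (V := R_NormedModule) D b a); auto. }
  unfold D in H.
  rewrite (RInt_point a (fun x : R => RInt (fun y : R => f x y) c d)) in H.
  rewrite (RInt_ext (fun y => RInt (fun s => f s y) a a) (fun _ => 0)) in H.
  2:{ intros; apply (RInt_point (V := R_CompleteNormedModule)). }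
  rewrite (RInt_const (V := R_CompleteNormedModule)) in H.
  change zero with 0 in H. unfold scal in H; simpl in H. unfold mult in H; simpl in H. lra.
Qed.

Definition Ccont2 (f : R -> R -> C) : Prop := forall x y : R,
  continuity_2d_pt (fun u v => Re (f u v)) x y /\
  continuity_2d_pt (fun u v => Im (f u v)) x y.

Lemma Ccont2_const (c : C) : Ccont2 (fun _ _ => c).
Proof. intros x y; split; apply continuity_2d_pt_const. Qed.

Lemma Ccont2_fst (f : R -> C) : Ccont f -> Ccont2 (fun u _ => f u).
Proof.
  intros H x y; destruct (H x) as [H1 H2]; split.
  - apply (continuity_1d_2d_pt_comp (fun t => Re (f t)) (fun u v => u)).
    + apply continuity_pt_filterlim, H1.
    + apply continuity_2d_pt_id1.
  - apply (continuity_1d_2d_pt_comp (fun t => Im (f t)) (fun u v => u)).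
    + apply continuity_pt_filterlim, H2.
    + apply continuity_2d_pt_id1.
Qed.

Lemma Ccont2_snd (f : R -> C) : Ccont f -> Ccont2 (fun _ v => f v).
Proof.
  intros H x y; destruct (Ccont2_fst f H y x); split;
    apply (continuity_2d_swap (fun u v => _ (f u))); assumption.
Qed.

Lemma Ccont2_plus (f g : R -> R -> C) :
  Ccont2 f -> Ccont2 g -> Ccont2 (fun u v => f u v + g u v)%C.
Proof.
  intros Hf Hg x y; destruct (Hf x y), (Hg x y); split; simpl;
    apply continuity_2d_pt_plus; assumption.
Qed.

Lemma Ccont2_minus (f g : R -> R -> C) :
  Ccont2 f -> Ccont2 g -> Ccont2 (fun u v => f u v - g u v)%C.
Proof.
  intros Hf Hg x y; destruct (Hf x y), (Hg x y); split; simpl;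
    apply continuity_2d_pt_minus; assumption.
Qed.

Lemma Ccont2_mult (f g : R -> R -> C) :
  Ccont2 f -> Ccont2 g -> Ccont2 (fun u v => f u v * g u v)%C.
Proof.
  intros Hf Hg x y; destruct (Hf x y), (Hg x y); split; simpl;
    [apply continuity_2d_pt_minus|apply continuity_2d_pt_plus];
    apply continuity_2d_pt_mult; assumption.
Qed.

Lemma Ccont2_Cexp (f : R -> R -> C) : Ccont2 f -> Ccont2 (fun u v => Cexp (f u v)).
Proof.
  intros Hf x y; destruct (Hf x y) as [H1 H2]; split; simpl;
    apply continuity_2d_pt_mult;
    (apply (continuity_1d_2d_pt_comp exp); [|exact H1]) ||
    (apply (continuity_1d_2d_pt_comp cos); [|exact H2]) ||
    (apply (continuity_1d_2d_pt_comp sin); [|exact H2]);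
    apply derivable_continuous_pt;
    first [apply derivable_pt_exp|apply derivable_pt_cos|apply derivable_pt_sin].
Qed.

Lemma CInt_swap_order (f : R -> R -> C) (a b c d : R) : Ccont2 f ->
  CInt (fun x => CInt (fun y => f x y) c d) a b =
  CInt (fun y => CInt (fun x => f x y) a b) c d.
Proof.
  intros H; apply C_eq; simpl; apply (RInt_swap_order (fun u v => _ (f u v))); apply H.
Qed.

Lemma CInt_param_cont (f : R -> R -> C) (c d : R) : Ccont2 f ->
  Ccont (fun x => CInt (fun y => f x y) c d).
Proof.
  intros H x; split; simpl; apply (RInt_param_continuous (fun u v => _ (f u v))); apply H.
Qed.

(** * Absolutely convergent integrals over the real line *)

Definition is_CInt_line (f : R -> C) (l : C) : Prop :=
  is_RInt_gen (V := C_R_NormedModule) f (Rbar_locally m_infty) (Rbar_locally p_infty) l.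

Definition CInt_line (f : R -> C) : C :=
  RInt_gen (V := C_R_CompleteNormedModule) f (Rbar_locally m_infty) (Rbar_locally p_infty).

(** The constant [M] is an explicit parameter because estimates must be uniform over families: any
    integral is at most [M * PI], and what lies outside [[- N, N]] contributes at most
    [M * (PI - 2 * atan N)], for all functions with the same [M]. *)
Definition dominated (f : R -> C) (M : R) : Prop :=
  Ccont f /\ forall u, Cmod (f u) <= M / (1 + u ^ 2).

Lemma CInt_line_ext (f g : R -> C) : (forall x, f x = g x) -> CInt_line f = CInt_line g.
Proof.
  intros E. f_equal. apply functional_extensionality, E.
Qed.

Lemma is_CInt_line_unique (f : R -> C) (l : C) : is_CInt_line f l -> CInt_line f = l.
Proof.
  intros H. exact (is_RInt_gen_unique (V := C_R_CompleteNormedModule)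
    (Fa := Rbar_locally m_infty) (Fb := Rbar_locally p_infty) f l H).
Qed.

Lemma is_CInt_line_ext (f g : R -> C) (l : C) :
  (forall x, f x = g x) -> is_CInt_line f l -> is_CInt_line g l.
Proof.
  intros E H. refine (is_RInt_gen_ext (V := C_R_NormedModule)
    (Fa := Rbar_locally m_infty) (Fb := Rbar_locally p_infty) f g l _ H).
  apply filter_forall; intros; apply E.
Qed.

Lemma Cmod_lt_Re_Im (z : C) (eps : R) : Cmod z < eps -> Rabs (Re z) < eps /\ Rabs (Im z) < eps.
Proof.
  intros H; split.
  - eapply Rle_lt_trans; [apply re_le_Cmod|exact H].
  - eapply Rle_lt_trans; [|exact H].
    eapply Rle_trans; [|apply Rmax_Cmod]. apply Rmax_r.
Qed.

Lemma is_CInt_line_iff (f : R -> C) (l : C) : Ccont f ->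
  (is_CInt_line f l <->
   forall eps, 0 < eps -> exists N0, 0 <= N0 /\
     forall a b, a <= - N0 -> N0 <= b -> Cmod (CInt f a b - l) < eps).
Proof.
  intros Hf; split.
  - intros H eps Heps.
    assert (Hl : locally (T := C_R_NormedModule) l (fun z => Cmod (z - l)%C < eps)).
    (* Balls of [C_R_NormedModule] are products of real balls, hence one half of [eps] for each
       component. *)
    { assert (He2 : 0 < eps / 2) by lra.
      exists (mkposreal _ He2). intros y [H1 H2].
      change (Rabs (Re y - Re l) < eps / 2) in H1.
      change (Rabs (Im y - Im l) < eps / 2) in H2.
      eapply Rle_lt_trans; [apply Cmod_le_Re_Im|].
      change (Rabs (Re y - Re l) + Rabs (Im y - Im l) < eps). lra. }
    destruct (H _ Hl) as [Q1 Q2 HQ HR HP]. destruct HQ as [m Hm], HR as [p Hp].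
    (* The [+ 1] provides the strict inequalities [a < m] and [p < b] that the filters at infinity
       ask for. *)
    exists (Rmax (Rabs m + 1) (Rabs p + 1)).
    assert (Hm0 := Rabs_pos m). assert (Hp0 := Rabs_pos p).
    assert (Hx := Rmax_l (Rabs m + 1) (Rabs p + 1)).
    assert (Hy := Rmax_r (Rabs m + 1) (Rabs p + 1)).
    split; [lra|]. intros a b Ha Hb.
    destruct (HP a b) as [z [Hz1 Hz2]].
    + apply Hm. generalize (Rcomplements.Rabs_maj2 m); lra.
    + apply Hp. generalize (Rle_abs p); lra.
    + rewrite (CInt_unique f a b z) by exact Hz1. exact Hz2.
  - intros H P [eps HP].
    destruct (H eps (cond_pos eps)) as [N0 [_ HN]].
    exists (fun a => a < - N0) (fun b => N0 < b).
    + exists (- N0); auto.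
    + exists N0; auto.
    + intros a b Ha Hb. exists (CInt f a b). split; [apply CInt_correct, Hf|].
      apply HP.
      assert (Hab := HN a b (Rlt_le _ _ Ha) (Rlt_le _ _ Hb)).
      apply Cmod_lt_Re_Im in Hab. exact Hab.
Qed.

Lemma mult_div_add1_lt (c eps : R) : 0 <= c -> 0 < eps -> c * (eps / (c + 1)) < eps.
Proof.
  intros Hc Heps. apply Rmult_lt_reg_r with (c + 1); [lra|].
  replace (c * (eps / (c + 1)) * (c + 1)) with (c * eps) by (field; lra). nra.
Qed.

Lemma is_CInt_line_scal (c : C) (f : R -> C) (l : C) : Ccont f ->
  is_CInt_line f l -> is_CInt_line (fun x => c * f x)%C (c * l)%C.
Proof.
  intros Hf H. apply is_CInt_line_iff; [apply Ccont_mult; [apply Ccont_const|exact Hf]|].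
  intros eps Heps.
  assert (Hc := Cmod_ge_0 c).
  destruct (proj1 (is_CInt_line_iff f l Hf) H (eps / (Cmod c + 1))) as [N [HN0 HN]].
  { apply Rdiv_lt_0_compat; lra. }
  exists N; split; [exact HN0|]. intros a b Ha Hb.
  rewrite CInt_scal by exact Hf.
  replace (c * CInt f a b - c * l)%C with (c * (CInt f a b - l))%C by ring.
  rewrite Cmod_mult. specialize (HN a b Ha Hb).
  apply Rle_lt_trans with (Cmod c * (eps / (Cmod c + 1))).
  - apply Rmult_le_compat_l; lra.
  - apply mult_div_add1_lt; assumption.
Qed.

Lemma is_CInt_line_plus (f g : R -> C) (l m : C) :
  is_CInt_line f l -> is_CInt_line g m -> is_CInt_line (fun x => f x + g x)%C (l + m)%C.
Proof.
  exact (is_RInt_gen_plus (V := C_R_NormedModule)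
    (Fa := Rbar_locally m_infty) (Fb := Rbar_locally p_infty) f g l m).
Qed.

Lemma is_CInt_line_minus (f g : R -> C) (l m : C) :
  is_CInt_line f l -> is_CInt_line g m -> is_CInt_line (fun x => f x - g x)%C (l - m)%C.
Proof.
  exact (is_RInt_gen_minus (V := C_R_NormedModule)
    (Fa := Rbar_locally m_infty) (Fb := Rbar_locally p_infty) f g l m).
Qed.

Lemma one_plus_sqr_pos (u : R) : 0 < 1 + u ^ 2.
Proof. nra. Qed.

Lemma is_RInt_inv_one_plus_sqr (M a b : R) :
  is_RInt (fun u => M / (1 + u ^ 2)) a b (M * (atan b - atan a)).
Proof.
  replace (M * (atan b - atan a)) with (minus (M * atan b) (M * atan a))
    by (unfold minus, plus, opp; simpl; ring).
  apply (is_RInt_derive (V := R_CompleteNormedModule) (fun u => M * atan u)).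
  - intros x _. auto_derive; [trivial|]. unfold Rsqr; field.
    generalize (one_plus_sqr_pos x); lra.
  - intros x _. apply (ex_derive_continuous (K := R_AbsRing) (V := R_NormedModule)).
    auto_derive. generalize (one_plus_sqr_pos x); simpl; lra.
Qed.

Lemma dominated_pos (f : R -> C) (M : R) : dominated f M -> 0 <= M.
Proof.
  intros [_ H]. specialize (H 0). generalize (Cmod_ge_0 (f 0)); intros H0.
  replace (M / (1 + 0 ^ 2)) with M in H by field. lra.
Qed.

Lemma dominated_CInt (f : R -> C) (M a b : R) : dominated f M -> a <= b ->
  Cmod (CInt f a b) <= M * (atan b - atan a).
Proof.
  intros [H1 H2] Hab. apply (CInt_le f (fun u => M / (1 + u ^ 2)) a b); auto.
  apply is_RInt_inv_one_plus_sqr.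
Qed.

Lemma dominated_CInt_PI (f : R -> C) (M a b : R) : dominated f M -> a <= b ->
  Cmod (CInt f a b) <= M * PI.
Proof.
  intros H Hab. eapply Rle_trans; [apply dominated_CInt; eassumption|].
  apply Rmult_le_compat_l; [eapply dominated_pos, H|].
  generalize (atan_bound a), (atan_bound b); lra.
Qed.

Lemma dominated_CInt_tail (f : R -> C) (M N a b : R) : dominated f M -> 0 <= N ->
  a <= - N -> N <= b ->
  Cmod (CInt f a b - CInt f (- N) N) <= M * (PI - 2 * atan N).
Proof.
  intros H HN Ha Hb.
  rewrite <- (CInt_Chasles f a (- N) b), <- (CInt_Chasles f (- N) N b) by apply H.
  replace (CInt f a (- N) + (CInt f (- N) N + CInt f N b) - CInt f (- N) N)%C
    with (CInt f a (- N) + CInt f N b)%C by ring.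
  eapply Rle_trans; [apply Cmod_triangle|].
  assert (H1 := dominated_CInt f M a (- N) H Ha).
  assert (H2 := dominated_CInt f M N b H Hb).
  rewrite atan_opp in H1.
  assert (H0 := dominated_pos f M H).
  generalize (atan_bound a), (atan_bound b); intros. nra.
Qed.

Lemma atan_tail (eps : R) : 0 < eps ->
  exists N0, 0 <= N0 /\ forall N, N0 <= N -> PI - 2 * atan N < eps.
Proof.
  (* With [N >= tan (PI / 2 - e)] the tail is at most [2 * e <= eps / 2]. The cap 1 is below
     [PI / 2], so that [PI / 2 - e] stays where [atan] inverts [tan]. *)
  intros Heps. set (e := Rmin (eps / 4) 1).
  assert (He1 : e <= eps / 4) by apply Rmin_l.
  assert (He2 : e <= 1) by apply Rmin_r.
  assert (He0 : 0 < e) by (apply Rmin_pos; lra).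
  assert (HPI := PI2_3_2).
  exists (Rmax 0 (tan (PI / 2 - e))). split; [apply Rmax_l|].
  intros N HN.
  assert (H : tan (PI / 2 - e) <= N) by (eapply Rle_trans; [apply Rmax_r|exact HN]).
  assert (Ha : PI / 2 - e <= atan N).
  { rewrite <- (atan_tan (PI / 2 - e)) by (unfold PI2 in *; lra).
    destruct H as [H|H]; [left; apply atan_increasing, H|rewrite H; right; reflexivity]. }
  lra.
Qed.

Lemma mult_atan_tail (M eps : R) : 0 <= M -> 0 < eps ->
  exists N0, 0 <= N0 /\ forall N, N0 <= N -> M * (PI - 2 * atan N) < eps.
Proof.
  intros HM Heps. destruct (atan_tail (eps / (M + 1))) as [N0 [H0 H]].
  { apply Rdiv_lt_0_compat; lra. }
  exists N0; split; [exact H0|]. intros N HN. specialize (H N HN).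
  apply Rle_lt_trans with (M * (eps / (M + 1))).
  - apply Rmult_le_compat_l; lra.
  - apply mult_div_add1_lt; assumption.
Qed.

(** Cauchy's criterion along the product of the two filters: integrals over two large intervals both
    differ from the one over [[- N, N]] by less than [eps / 2]. *)
Lemma dominated_ex (f : R -> C) (M : R) : dominated f M -> exists l, is_CInt_line f l.
Proof.
  intros H.
  assert (Hc : exists l : C_R_CompleteNormedModule,
    filterlim (fun ab : R * R => CInt f (fst ab) (snd ab) : C_R_CompleteNormedModule)
    (filter_prod (Rbar_locally m_infty) (Rbar_locally p_infty)) (locally l)).
  { apply (filterlim_locally_cauchy (U := C_R_CompleteNormedModule)
      (F := filter_prod (Rbar_locally m_infty) (Rbar_locally p_infty))).
    intros eps.
    assert (He : 0 < eps / 2) by (generalize (cond_pos eps); lra).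
    destruct (mult_atan_tail M (eps / 2) (dominated_pos f M H) He) as [N [HN0 HN]].
    specialize (HN N (Rle_refl N)).
    exists (fun ab => fst ab <= - N /\ N <= snd ab). split.
    - exists (fun a => a < - N) (fun b => N < b).
      + exists (- N); auto.
      + exists N; auto.
      + simpl; intros; lra.
    - intros [a b] [a' b'] [Ha Hb] [Ha' Hb']; simpl in *.
      assert (Hd : Cmod (CInt f a' b' - CInt f a b) < eps).
      { replace (CInt f a' b' - CInt f a b)%C
          with ((CInt f a' b' - CInt f (- N) N) + - (CInt f a b - CInt f (- N) N))%C by ring.
        eapply Rle_lt_trans; [apply Cmod_triangle|]. rewrite Cmod_opp.
        generalize (dominated_CInt_tail f M N a b H HN0 Ha Hb),
          (dominated_CInt_tail f M N a' b' H HN0 Ha' Hb'). lra. }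
      apply Cmod_lt_Re_Im in Hd. exact Hd. }
  destruct Hc as [l Hl]. exists l. intros P HP.
  specialize (Hl P HP). unfold filtermapi. unfold filtermap in Hl.
  eapply filter_imp; [|exact Hl].
  intros [a b] Hab. exists (CInt f a b). split; [apply CInt_correct, H|exact Hab].
Qed.

Lemma dominated_correct (f : R -> C) (M : R) : dominated f M -> is_CInt_line f (CInt_line f).
Proof.
  intros H. destruct (dominated_ex f M H) as [l Hl].
  rewrite (is_CInt_line_unique f l Hl). exact Hl.
Qed.

(** Carries a bound on finite integrals to the limit: [z = 0] bounds the integral itself, and a
    truncated integral as [z] bounds the tail. *)
Lemma Cmod_lim_le (f : R -> C) (l z : C) (B N : R) : Ccont f -> is_CInt_line f l ->
  (forall a b, a <= - N -> N <= b -> Cmod (CInt f a b - z) <= B) -> Cmod (l - z) <= B.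
Proof.
  intros Hf H HB. apply Rnot_lt_le; intros Hlt.
  destruct (proj1 (is_CInt_line_iff f l Hf) H (Cmod (l - z) - B)) as [N0 [_ HN]]; [lra|].
  set (K := Rmax N0 N).
  assert (K1 : N0 <= K) by apply Rmax_l. assert (K2 : N <= K) by apply Rmax_r.
  specialize (HN (- K) K ltac:(lra) ltac:(lra)).
  specialize (HB (- K) K ltac:(lra) ltac:(lra)).
  assert (Ht := Cmod_triangle (CInt f (- K) K - z) (- (CInt f (- K) K - l))).
  replace (CInt f (- K) K - z + - (CInt f (- K) K - l))%C with (l - z)%C in Ht by ring.
  rewrite Cmod_opp in Ht. lra.
Qed.

Lemma dominated_tail (f : R -> C) (M N : R) (l : C) : dominated f M -> is_CInt_line f l ->
  0 <= N -> Cmod (l - CInt f (- N) N) <= M * (PI - 2 * atan N).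
Proof.
  intros H Hl HN. eapply Cmod_lim_le; [apply H|exact Hl|].
  intros a b Ha Hb. apply dominated_CInt_tail; eassumption.
Qed.

(** For majorants other than [M / (1 + u ^ 2)]. The Poisson kernel needs this: its mass stays
    bounded as [d] tends to 0, but its maximum [2 / d] would force [M] to infinity. *)
Lemma is_CInt_line_le (f : R -> C) (G : R -> R) (V : R -> R -> R) (B : R) (l : C) :
  Ccont f -> is_CInt_line f l -> (forall u, Cmod (f u) <= G u) ->
  (forall a b, a <= b -> is_RInt G a b (V a b) /\ V a b <= B) -> Cmod l <= B.
Proof.
  intros Hf Hl HG HV. replace l with (l - 0)%C by ring.
  apply (Cmod_lim_le f l 0 B 0 Hf Hl). intros a b Ha Hb.
  assert (Hab : a <= b) by lra.
  replace (CInt f a b - 0)%C with (CInt f a b) by ring.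
  eapply Rle_trans; [|apply (HV a b Hab)].
  apply (CInt_le f G a b (V a b)); auto. apply HV, Hab.
Qed.

Lemma dominated_le (f : R -> C) (M : R) (l : C) : dominated f M -> is_CInt_line f l ->
  Cmod l <= M * PI.
Proof.
  intros H Hl. replace l with (l - 0)%C by ring.
  apply (Cmod_lim_le f l 0 (M * PI) 0 (proj1 H) Hl). intros a b Ha Hb.
  replace (CInt f a b - 0)%C with (CInt f a b) by ring.
  apply dominated_CInt_PI; [exact H|lra].
Qed.

Lemma Ccont_uniform_limit (f : R -> C) :
  (forall eps, 0 < eps -> exists g, Ccont g /\ forall t, Cmod (f t - g t) <= eps) -> Ccont f.
Proof.
  intros H. apply Ccont_of_continuous. intros x. apply filterlim_locally; intros eps.
  (* Four quarters: the error of [g] at [x] and at [y], and the variation of each component of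
     [g]. *)
  assert (He : 0 < eps / 4) by (generalize (cond_pos eps); lra).
  destruct (H _ He) as [g [Hg Hfg]].
  assert (Hgx := proj1 (filterlim_locally _ _) (Ccont_continuous g x Hg) (mkposreal _ He)).
  revert Hgx. apply filter_imp. intros y [H1 H2]; simpl in H1, H2.
  change (Rabs (Re (g y) - Re (g x)) < eps / 4) in H1.
  change (Rabs (Im (g y) - Im (g x)) < eps / 4) in H2.
  assert (Hd : Cmod (f y - f x) < eps).
  { replace (f y - f x)%C with ((f y - g y) + ((g y - g x) + - (f x - g x)))%C by ring.
    eapply Rle_lt_trans; [apply Cmod_triangle|].
    assert (Ht := Cmod_triangle (g y - g x) (- (f x - g x))). rewrite Cmod_opp in Ht.
    assert (Hg2 := Cmod_le_Re_Im (g y - g x)%C).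
    change (Cmod (g y - g x) <= Rabs (Re (g y) - Re (g x)) + Rabs (Im (g y) - Im (g x))) in Hg2.
    generalize (Hfg x), (Hfg y). lra. }
  apply Cmod_lt_Re_Im in Hd. exact Hd.
Qed.

Lemma dominated_scal (c : C) (f : R -> C) (M : R) : dominated f M ->
  dominated (fun x => c * f x)%C (Cmod c * M).
Proof.
  intros [H1 H2]; split; [apply Ccont_mult; [apply Ccont_const|exact H1]|].
  intros u. rewrite Cmod_mult. unfold Rdiv; rewrite Rmult_assoc.
  apply Rmult_le_compat_l; [apply Cmod_ge_0|apply H2].
Qed.

Lemma dominated_mult_bounded (f g : R -> C) (M K : R) : dominated f M -> Ccont g ->
  (forall u, Cmod (g u) <= K) -> dominated (fun x => f x * g x)%C (M * K).
Proof.
  intros [H1 H2] Hg HK; split; [apply Ccont_mult; assumption|].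
  intros u. rewrite Cmod_mult.
  replace (M * K / (1 + u ^ 2)) with (M / (1 + u ^ 2) * K) by (unfold Rdiv; ring).
  apply Rmult_le_compat; auto using Cmod_ge_0.
Qed.

Lemma dominated_ext (f g : R -> C) (M : R) : (forall x, f x = g x) -> dominated f M -> dominated g M.
Proof.
  intros E [H1 H2]; split; [apply (Ccont_ext f); assumption|].
  intros u; rewrite <- E; apply H2.
Qed.

(** * The multiplication formula *)

Definition cis (x : R) : C := (cos x, sin x).

Lemma Cmod_cis (x : R) : Cmod (cis x) = 1.
Proof.
  unfold Cmod, cis; simpl. replace (cos x * (cos x * 1) + sin x * (sin x * 1)) with 1.
  - apply sqrt_1.
  - generalize (sin2_cos2 x); unfold Rsqr; lra.
Qed.

Lemma cis_cont (k : R) : Ccont (fun x => cis (k * x)).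
Proof.
  intros x; split; simpl; apply (ex_derive_continuous (K := R_AbsRing) (V := R_NormedModule));
    auto_derive; trivial.
Qed.

Lemma dominated_cis (f : R -> C) (M k : R) : dominated f M ->
  dominated (fun x => f x * cis (k * x))%C M.
Proof.
  intros H. replace M with (M * 1) by ring.
  apply dominated_mult_bounded; [exact H|apply cis_cont|intros; rewrite Cmod_cis; lra].
Qed.

(** The parameter [k] is the sign of the transform: 1 in the inversion of the Gamma integral, and -1
    in the Mellin-Barnes integral, where [Gamma(c - v)] runs down its vertical line as [v] runs
    up. *)
Definition fourier (k : R) (f : R -> C) (t : R) : C :=
  CInt_line (fun u => f u * cis (k * t * u))%C.

Lemma Ccont2_mult_cis (k : R) (A B : R -> C) : Ccont A -> Ccont B ->
  Ccont2 (fun u v => A u * (B v * cis (k * u * v)))%C.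
Proof.
  intros HA HB. apply Ccont2_mult; [apply Ccont2_fst, HA|].
  apply Ccont2_mult; [apply Ccont2_snd, HB|].
  assert (Hk : forall x y, continuity_2d_pt (fun u v => k * u * v) x y).
  { intros x y. apply continuity_2d_pt_mult; [apply continuity_2d_pt_mult|];
      [apply continuity_2d_pt_const|apply continuity_2d_pt_id1|apply continuity_2d_pt_id2]. }
  intros x y; split; simpl.
  - apply (continuity_1d_2d_pt_comp cos); [apply continuity_cos|apply Hk].
  - apply (continuity_1d_2d_pt_comp sin); [apply continuity_sin|apply Hk].
Qed.

Lemma fourier_correct (k : R) (f : R -> C) (M t : R) : dominated f M ->
  is_CInt_line (fun u => f u * cis (k * t * u))%C (fourier k f t).
Proof. intros H. apply dominated_correct with M. apply dominated_cis, H. Qed.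

Lemma fourier_bound (k : R) (f : R -> C) (M t : R) : dominated f M ->
  Cmod (fourier k f t) <= M * PI.
Proof.
  intros H. eapply dominated_le; [apply dominated_cis, H|apply (fourier_correct k f M t H)].
Qed.

Lemma fourier_tail (k : R) (f : R -> C) (M t N : R) : dominated f M -> 0 <= N ->
  Cmod (fourier k f t - CInt (fun u => f u * cis (k * t * u))%C (- N) N)
  <= M * (PI - 2 * atan N).
Proof.
  intros H HN. apply dominated_tail; [apply dominated_cis, H|apply (fourier_correct k f M t H)|exact HN].
Qed.

Lemma fourier_partial_cont (k : R) (f : R -> C) (N : R) : Ccont f ->
  Ccont (fun t => CInt (fun u => f u * cis (k * t * u))%C (- N) N).
Proof.
  intros H.
  apply (Ccont_ext (fun t => CInt (fun u => 1 * (f u * cis (k * t * u)))%C (- N) N)).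
  - intros x. apply CInt_ext. intros; ring.
  - apply (CInt_param_cont (fun t u => 1 * (f u * cis (k * t * u)))%C).
    apply (Ccont2_mult_cis k (fun _ => RtoC 1) f); [apply Ccont_const|exact H].
Qed.

(** The truncated transforms are continuous and converge uniformly, since the bound on the tail does
    not involve [t]. *)
Lemma fourier_cont (k : R) (f : R -> C) (M : R) : dominated f M -> Ccont (fourier k f).
Proof.
  intros H. apply Ccont_uniform_limit. intros eps Heps.
  destruct (mult_atan_tail M eps (dominated_pos f M H) Heps) as [N [HN0 HN]].
  exists (fun t => CInt (fun u => f u * cis (k * t * u))%C (- N) N). split.
  - apply fourier_partial_cont, H.
  - intros t. eapply Rle_trans; [apply (fourier_tail k f M t N H HN0)|].
    left; apply HN; lra.
Qed.

(** Both sides are iterated integrals of [A t * B u * exp (i k t u)]. Over the square [[- N, N]^2]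
    they agree by Fubini, and each full integral is as close as desired to the one over the
    square. *)
Lemma multiplication_formula (k : R) (A B : R -> C) (MA MB : R) :
  dominated A MA -> dominated B MB ->
  CInt_line (fun t => A t * fourier k B t)%C = CInt_line (fun u => B u * fourier k A u)%C.
Proof.
  intros HA HB.
  assert (PA := dominated_pos A MA HA). assert (PB := dominated_pos B MB HB).
  assert (HPI := PI_RGT_0).
  (* The factor 2 counts two equal errors: truncating the outer integral, and truncating the
     transform inside it. Stating this for all [A] and [B] lets it serve for both sides. *)
  assert (Happrox : forall A B MA MB, dominated A MA -> dominated B MB -> forall N, 0 <= N ->
    Cmod (CInt_line (fun t => A t * fourier k B t)%C -
      CInt (fun t => A t * CInt (fun u => B u * cis (k * t * u))%C (- N) N)%C (- N) N) <=
    2 * MA * MB * PI * (PI - 2 * atan N)).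
  { clear A B MA MB HA HB PA PB. intros A B MA MB HA HB N HN.
    assert (PA := dominated_pos A MA HA). assert (PB := dominated_pos B MB HB).
    assert (D : dominated (fun t => A t * fourier k B t)%C (MA * (MB * PI))).
    { apply dominated_mult_bounded; [exact HA|eapply fourier_cont, HB|].
      intros u; apply fourier_bound, HB. }
    assert (H1 := dominated_tail _ _ N _ D (dominated_correct _ _ D) HN).
    assert (D2 : dominated (fun t => A t * (fourier k B t -
      CInt (fun u => B u * cis (k * t * u))%C (- N) N))%C (MA * (MB * (PI - 2 * atan N)))).
    { apply dominated_mult_bounded; [exact HA| |].
      - apply Ccont_minus; [eapply fourier_cont, HB|apply fourier_partial_cont, HB].
      - intros u; apply fourier_tail; assumption. }
    assert (H2 := dominated_CInt_PI _ _ (- N) N D2 ltac:(lra)).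
    rewrite (CInt_ext _ (fun t => A t * fourier k B t -
      A t * CInt (fun u => B u * cis (k * t * u))%C (- N) N)%C) in H2 by (intros; ring).
    rewrite CInt_minus in H2.
    2:{ apply Ccont_mult; [apply HA|eapply fourier_cont, HB]. }
    2:{ apply Ccont_mult; [apply HA|apply fourier_partial_cont, HB]. }
    match goal with |- Cmod (?x - ?z) <= _ =>
      replace (x - z)%C with ((x - CInt (fun t => A t * fourier k B t)%C (- N) N) +
        (CInt (fun t => A t * fourier k B t)%C (- N) N - z))%C by ring end.
    eapply Rle_trans; [apply Cmod_triangle|].
    eapply Rle_trans; [apply Rplus_le_compat; [exact H1|exact H2]|].
    right; ring. }
  set (X := CInt_line (fun t => A t * fourier k B t)%C).
  set (Y := CInt_line (fun u => B u * fourier k A u)%C).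
  destruct (Ceq_dec X Y) as [|Hne]; [assumption|exfalso].
  assert (Hpos : 0 < Cmod (X - Y)) by (apply Cmod_gt_0, Cminus_eq_contra, Hne).
  assert (HK : 0 <= 4 * MA * MB * PI)
    by (apply Rmult_le_pos; [apply Rmult_le_pos; [lra|]|]; lra).
  destruct (mult_atan_tail _ _ HK Hpos) as [N [HN0 HN]].
  specialize (HN N (Rle_refl N)).
  assert (H1 := Happrox A B MA MB HA HB N HN0). assert (H2 := Happrox B A MB MA HB HA N HN0).
  fold X in H1. fold Y in H2.
  assert (E : CInt (fun t => A t * CInt (fun u => B u * cis (k * t * u))%C (- N) N)%C (- N) N =
    CInt (fun u => B u * CInt (fun t => A t * cis (k * u * t))%C (- N) N)%C (- N) N).
  { rewrite (CInt_ext _ (fun t => CInt (fun u => A t * (B u * cis (k * t * u)))%C (- N) N)).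
    - rewrite (CInt_swap_order (fun t u => A t * (B u * cis (k * t * u)))%C)
        by (apply Ccont2_mult_cis; [apply HA|apply HB]).
      apply CInt_ext. intros u.
      rewrite <- CInt_scal.
      + apply CInt_ext. intros t. replace (k * u * t) with (k * t * u) by ring. ring.
      + apply Ccont_mult; [apply HA|apply cis_cont].
    - intros t. symmetry; apply CInt_scal. apply Ccont_mult; [apply HB|apply cis_cont]. }
  rewrite E in H1.
  set (Z := CInt _ (- N) N) in H1, H2.
  assert (Ht := Cmod_triangle (X - Z) (- (Y - Z))).
  replace (X - Z + - (Y - Z))%C with (X - Y)%C in Ht by ring.
  rewrite Cmod_opp in Ht. nra.
Qed.

(** * The complex exponential *)

Lemma Cexp_plus (z w : C) : Cexp (z + w) = (Cexp z * Cexp w)%C.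
Proof.
  apply C_eq; simpl; rewrite exp_plus, ?cos_plus, ?sin_plus; unfold Re, Im; ring.
Qed.

Lemma Cexp_0 : Cexp 0 = 1.
Proof. apply C_eq; simpl; rewrite exp_0, ?cos_0, ?sin_0; ring. Qed.

Lemma Cmod_Cexp (z : C) : Cmod (Cexp z) = exp (Re z).
Proof.
  replace (Cexp z) with (exp (Re z) * cis (Im z))%C by (apply C_eq; simpl; ring).
  rewrite Cmod_mult, Cmod_cis, Cmod_R, Rabs_pos_eq; [ring|left; apply exp_pos].
Qed.

Lemma Cexp_neq_0 (z : C) : Cexp z <> 0.
Proof. apply Cmod_gt_0. rewrite Cmod_Cexp. apply exp_pos. Qed.

Lemma Cexp_opp (z : C) : Cexp (- z) = (/ Cexp z)%C.
Proof.
  transitivity (Cexp z * Cexp (- z) * / Cexp z)%C; [field; apply Cexp_neq_0|].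
  rewrite <- Cexp_plus. replace (z + - z)%C with (RtoC 0) by ring.
  rewrite Cexp_0. ring.
Qed.

Lemma Cexp_Ci (x : R) : Cexp (Ci * x) = cis x.
Proof.
  apply C_eq; simpl; replace (0 * x - 1 * 0) with 0 by ring;
    replace (0 * 0 + 1 * x) with x by ring; rewrite exp_0; ring.
Qed.

Lemma Cexp_RtoC (x : R) : Cexp x = exp x.
Proof. apply C_eq; simpl; rewrite ?cos_0, ?sin_0; ring. Qed.

Lemma Ccont_Cexp (f : R -> C) : Ccont f -> Ccont (fun x => Cexp (f x)).
Proof.
  intros H x; destruct (H x) as [H1 H2]; split; simpl;
    apply (continuous_mult (K := R_AbsRing)).
  - apply (continuous_comp (fun t => Re (f t)) exp); [exact H1|].
    apply continuity_pt_filterlim, derivable_continuous_pt, derivable_pt_exp.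
  - apply (continuous_comp (fun t => Im (f t)) cos); [exact H2|].
    apply continuity_pt_filterlim, continuity_cos.
  - apply (continuous_comp (fun t => Re (f t)) exp); [exact H1|].
    apply continuity_pt_filterlim, derivable_continuous_pt, derivable_pt_exp.
  - apply (continuous_comp (fun t => Im (f t)) sin); [exact H2|].
    apply continuity_pt_filterlim, continuity_sin.
Qed.

Lemma Ccont_id : Ccont RtoC.
Proof. intros x; split; simpl; [apply continuous_id|apply continuous_const]. Qed.

Definition is_derC (f : R -> C) (x : R) (d : C) : Prop :=
  is_derive (fun t => Re (f t)) x (Re d) /\ is_derive (fun t => Im (f t)) x (Im d).

Lemma is_derC_affine (a b : C) (x : R) : is_derC (fun t => a + t * b)%C x b.
Proof.
  split; simpl; auto_derive; trivial; unfold Re, Im; ring.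
Qed.

Lemma is_derC_minus (f g : R -> C) (x : R) (d e : C) :
  is_derC f x d -> is_derC g x e -> is_derC (fun t => f t - g t)%C x (d - e)%C.
Proof.
  intros [H1 H2] [H3 H4]; split; simpl;
  [apply (is_derive_minus (V := R_NormedModule) (fun t => Re (f t)) (fun t => Re (g t)))
  |apply (is_derive_minus (V := R_NormedModule) (fun t => Im (f t)) (fun t => Im (g t)))]; assumption.
Qed.

Lemma is_derC_Cexp (f : R -> C) (x : R) (d : C) :
  is_derC f x d -> is_derC (fun t => Cexp (f t)) x (d * Cexp (f x))%C.
Proof.
  intros [H1 H2].
  assert (Hg : forall (u v : R -> R) (du dv : R), is_derive u x du -> is_derive v x dv ->
    is_derive (fun t => exp (u t) * cos (v t)) x (exp (u x) * (du * cos (v x) - dv * sin (v x))) /\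
    is_derive (fun t => exp (u t) * sin (v t)) x (exp (u x) * (du * sin (v x) + dv * cos (v x)))).
  { clear. intros u v du dv Hu Hv. split; auto_derive.
    - split; [exists du; exact Hu|split; [exists dv; exact Hv|trivial]].
    - replace (Derive (fun t => u t) x) with du by (symmetry; exact (is_derive_unique _ _ _ Hu)).
      replace (Derive (fun t => v t) x) with dv by (symmetry; exact (is_derive_unique _ _ _ Hv)).
      ring.
    - split; [exists du; exact Hu|split; [exists dv; exact Hv|trivial]].
    - replace (Derive (fun t => u t) x) with du by (symmetry; exact (is_derive_unique _ _ _ Hu)).
      replace (Derive (fun t => v t) x) with dv by (symmetry; exact (is_derive_unique _ _ _ Hv)).
      ring. }
  destruct (Hg _ _ _ _ H1 H2) as [G1 G2]. split.
  - replace (Re (d * Cexp (f x))%C) with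
      (exp (Re (f x)) * (Re d * cos (Im (f x)) - Im d * sin (Im (f x))))
      by (simpl; unfold Re, Im; ring).
    exact G1.
  - replace (Im (d * Cexp (f x))%C) with
      (exp (Re (f x)) * (Re d * sin (Im (f x)) + Im d * cos (Im (f x))))
      by (simpl; unfold Re, Im; ring).
    exact G2.
Qed.

Lemma is_derC_ext (f g : R -> C) (x : R) (d : C) :
  (forall t, f t = g t) -> is_derC f x d -> is_derC g x d.
Proof.
  intros E [H1 H2]; split.
  - eapply is_derive_ext; [intros; rewrite <- E; reflexivity|exact H1].
  - eapply is_derive_ext; [intros; rewrite <- E; reflexivity|exact H2].
Qed.

Lemma CInt_derC (f df : R -> C) (a b : R) :
  (forall x, is_derC f x (df x)) -> Ccont df -> CInt df a b = (f b - f a)%C.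
Proof. intros H Hc; apply CInt_derive; [apply H|apply H|exact Hc]. Qed.

(** * The Gamma integral on rotated lines *)

(** The square of [1 + x / 2 <= exp (x / 2)]. *)
Lemma exp_ge_quadratic (x : R) : 0 <= x -> 1 + x + x ^ 2 / 4 <= exp x.
Proof.
  intros Hx. replace (exp x) with (exp (x / 2) * exp (x / 2))
    by (rewrite <- exp_plus; f_equal; field).
  generalize (exp_ineq1_le (x / 2)). nra.
Qed.

(** Converts exponential decay into the standard majorant. The constant is chosen so that its
    product with [1 + eta ^ 2 * t ^ 2 / 4], a lower bound of [exp (eta * Rabs t)], is [1 + t ^ 2]
    plus nonnegative terms. *)
Lemma exp_neg_abs_bound (eta t : R) : 0 < eta ->
  exp (- (eta * Rabs t)) <= (1 + 4 / eta ^ 2) / (1 + t ^ 2).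
Proof.
  intros He.
  assert (H := exp_ge_quadratic (eta * Rabs t)
    ltac:(apply Rmult_le_pos; [lra|apply Rabs_pos])).
  rewrite exp_Ropp.
  replace ((eta * Rabs t) ^ 2) with (eta ^ 2 * t ^ 2) in H
    by (rewrite Rpow_mult_distr, pow2_abs; reflexivity).
  assert (Hp : 0 <= eta * Rabs t) by (apply Rmult_le_pos; [lra|apply Rabs_pos]).
  assert (He2 : 0 < eta ^ 2) by (apply pow_lt; lra).
  assert (Ht2 := one_plus_sqr_pos t).
  apply Rle_trans with (/ (1 + eta ^ 2 * t ^ 2 / 4)).
  - apply Rinv_le_contravar; [|lra]. generalize (pow2_ge_0 t); nra.
  - assert (Hq : 0 < 1 + eta ^ 2 * t ^ 2 / 4) by (generalize (pow2_ge_0 t); nra).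
    apply Rmult_le_reg_r with ((1 + eta ^ 2 * t ^ 2 / 4) * (1 + t ^ 2)); [apply Rmult_lt_0_compat; lra|].
    replace (/ (1 + eta ^ 2 * t ^ 2 / 4) * ((1 + eta ^ 2 * t ^ 2 / 4) * (1 + t ^ 2)))
      with (1 + t ^ 2) by (field; lra).
    replace ((1 + 4 / eta ^ 2) / (1 + t ^ 2) * ((1 + eta ^ 2 * t ^ 2 / 4) * (1 + t ^ 2)))
      with ((1 + 4 / eta ^ 2) * (1 + eta ^ 2 * t ^ 2 / 4)) by (field; split; lra).
    replace ((1 + 4 / eta ^ 2) * (1 + eta ^ 2 * t ^ 2 / 4))
      with (1 + t ^ 2 + (4 / eta ^ 2 + eta ^ 2 * t ^ 2 / 4)) by (field; lra).
    assert (0 < 4 / eta ^ 2) by (apply Rdiv_lt_0_compat; lra).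
    generalize (pow2_ge_0 t); nra.
Qed.

(** For [u <= 0] the factor [exp (s * u)] decays by itself. For [u > 0], [1 + u ^ 2 <= 4 * exp u]
    raises [s] to [s + 1], and [exp u >= u ^ 2 / 4] leaves the quadratic
    [(s + 1) * u - r * u ^ 2 / 4], whose maximum is [(s + 1) ^ 2 / r]. *)
Lemma exp_double_exp_bound (s r : R) : 0 < s -> 0 < r ->
  exists M, 0 <= M /\ forall u, exp (s * u - r * exp u) <= M / (1 + u ^ 2).
Proof.
  intros Hs Hr.
  set (M1 := 1 + 4 / s ^ 2). set (M2 := 4 * exp ((s + 1) ^ 2 / r)).
  assert (HM1 : 0 < M1).
  { unfold M1. assert (0 < s ^ 2) by (apply pow_lt; lra).
    assert (0 < 4 / s ^ 2) by (apply Rdiv_lt_0_compat; lra). lra. }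
  assert (HM2 : 0 < M2) by (unfold M2; generalize (exp_pos ((s + 1) ^ 2 / r)); lra).
  exists (M1 + M2). split; [lra|]. intros u. assert (Hu := one_plus_sqr_pos u).
  assert (Hi : 0 < / (1 + u ^ 2)) by (apply Rinv_0_lt_compat; lra).
  assert (Hdist : (M1 + M2) / (1 + u ^ 2) = M1 / (1 + u ^ 2) + M2 * / (1 + u ^ 2))
    by (field; lra).
  destruct (Rle_dec u 0) as [Hneg|Hpos].
  - apply Rle_trans with (M1 / (1 + u ^ 2)).
    + eapply Rle_trans; [|apply (exp_neg_abs_bound s u Hs)].
      rewrite Rabs_left1 by lra.
      replace (- (s * - u)) with (s * u) by ring.
      left; apply exp_increasing; generalize (exp_pos u); nra.
    + rewrite Hdist. generalize (Rmult_lt_0_compat _ _ HM2 Hi). lra.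
  - apply Rle_trans with (M2 * / (1 + u ^ 2)).
    + assert (Hq := exp_ge_quadratic u ltac:(lra)).
      apply Rmult_le_reg_r with (1 + u ^ 2); [lra|].
      rewrite Rmult_assoc, Rinv_l, Rmult_1_r by lra.
      unfold M2.
      apply Rle_trans with (exp (s * u - r * exp u) * (4 * exp u)).
      * apply Rmult_le_compat_l; [left; apply exp_pos|]. nra.
      * replace (exp (s * u - r * exp u) * (4 * exp u))
          with (4 * exp ((s + 1) * u - r * exp u))
          by (replace ((s + 1) * u - r * exp u) with ((s * u - r * exp u) + u) by ring;
              rewrite exp_plus; ring).
        apply Rmult_le_compat_l; [lra|].
        assert (Hle : (s + 1) * u - r * exp u <= (s + 1) ^ 2 / r).
        { apply Rmult_le_reg_l with r; [lra|].
          replace (r * ((s + 1) ^ 2 / r)) with ((s + 1) ^ 2) by (field; lra).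
          apply Rle_trans with (r * ((s + 1) * u - r * (u ^ 2 / 4))).
          - apply Rmult_le_compat_l; [lra|]. nra.
          - generalize (pow2_ge_0 (r * u / 2 - (s + 1))). nra. }
        destruct Hle as [Hlt|Heq]; [left; apply exp_increasing, Hlt|rewrite Heq; right; reflexivity].
    + rewrite Hdist. assert (0 < M1 / (1 + u ^ 2)) by (apply Rdiv_lt_0_compat; lra). lra.
Qed.

(* The substitution [t = exp u] in [t ^ (v - 1) * exp (- exp zeta * t)]. *)
Definition gamma_kernel (v zeta : C) (u : R) : C := Cexp (v * u - Cexp (u + zeta)).

Lemma Cmod_gamma_kernel (v zeta : C) (u : R) :
  Cmod (gamma_kernel v zeta u) = exp (Re v * u - exp (Re zeta) * cos (Im zeta) * exp u).
Proof.
  unfold gamma_kernel. rewrite Cmod_Cexp. f_equal.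
  simpl. rewrite exp_plus, Rplus_0_l. unfold Re, Im. ring.
Qed.

Lemma gamma_kernel_cont (v zeta : C) : Ccont (gamma_kernel v zeta).
Proof.
  apply Ccont_Cexp, Ccont_minus.
  - apply Ccont_mult; [apply Ccont_const|apply Ccont_id].
  - apply Ccont_Cexp, Ccont_plus; [apply Ccont_id|apply Ccont_const].
Qed.

Lemma cos_pos_of_abs (x : R) : Rabs x < PI / 2 -> 0 < cos x.
Proof. intros H; apply Rabs_def2 in H; apply cos_gt_0; lra. Qed.

(** The modulus of the kernel depends on [v] only through [Re v], hence the order of quantifiers:
    one [M] for a whole vertical line. *)
Lemma gamma_kernel_dominated (s : R) (zeta : C) : 0 < s -> Rabs (Im zeta) < PI / 2 ->
  exists M, forall v, Re v = s -> dominated (gamma_kernel v zeta) M.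
Proof.
  intros Hs Hz.
  destruct (exp_double_exp_bound s (exp (Re zeta) * cos (Im zeta)) Hs) as [M [_ HM]].
  { apply Rmult_lt_0_compat; [apply exp_pos|apply cos_pos_of_abs, Hz]. }
  exists M. intros v Hv; split; [apply gamma_kernel_cont|].
  intros u. rewrite Cmod_gamma_kernel, Hv. apply HM.
Qed.

Definition gamma_line (v zeta : C) : C := CInt_line (gamma_kernel v zeta).

Lemma gamma_line_correct (v zeta : C) : 0 < Re v -> Rabs (Im zeta) < PI / 2 ->
  is_CInt_line (gamma_kernel v zeta) (gamma_line v zeta).
Proof.
  intros Hv Hz. destruct (gamma_kernel_dominated (Re v) zeta Hv Hz) as [M HM].
  apply dominated_correct with M. apply HM; reflexivity.
Qed.

(** The entire function of [z] behind all the kernels: [gamma_kernel v zeta] is its restriction to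
    the line [R + zeta], up to the constant [exp (v zeta)]. *)
Definition wfun (v z : C) : C := Cexp (v * z - Cexp z).

Lemma wfun_shift (v zeta : C) (u : R) :
  wfun v (u + zeta) = (Cexp (v * zeta) * gamma_kernel v zeta u)%C.
Proof.
  unfold wfun, gamma_kernel. rewrite <- Cexp_plus. f_equal. ring.
Qed.

Lemma is_derC_wfun (v a b : C) (x : R) :
  is_derC (fun t => wfun v (a + t * b))%C x
    (b * ((v - Cexp (a + x * b)) * wfun v (a + x * b)))%C.
Proof.
  replace (b * ((v - Cexp (a + x * b)) * wfun v (a + x * b)))%C
    with ((v * b - b * Cexp (a + x * b)) * wfun v (a + x * b))%C by ring.
  unfold wfun. apply (is_derC_Cexp (fun t => v * (a + t * b) - Cexp (a + t * b))%C).
  apply is_derC_minus.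
  - apply (is_derC_ext (fun t => v * a + t * (v * b))%C); [intros; ring|].
    apply is_derC_affine.
  - apply is_derC_Cexp, is_derC_affine.
Qed.

(** The complex derivative of [wfun v]. *)
Definition dwfun (v z : C) : C := ((v - Cexp z) * wfun v z)%C.

Lemma dwfun_cont2 (v b : C) (f : R -> R -> C) : Ccont2 f ->
  Ccont2 (fun u t => b * dwfun v (f u t))%C.
Proof.
  intros H. apply Ccont2_mult; [apply Ccont2_const|].
  apply Ccont2_mult.
  - apply Ccont2_minus; [apply Ccont2_const|apply Ccont2_Cexp, H].
  - apply Ccont2_Cexp, Ccont2_minus; [|apply Ccont2_Cexp, H].
    apply Ccont2_mult; [apply Ccont2_const|exact H].
Qed.

Lemma wfun_cont (v : C) (f : R -> C) : Ccont f -> Ccont (fun u => wfun v (f u)).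
Proof.
  intros H. apply Ccont_Cexp, Ccont_minus; [|apply Ccont_Cexp, H].
  apply Ccont_mult; [apply Ccont_const|exact H].
Qed.

Lemma dwfun_cont (v b : C) (f : R -> C) : Ccont f -> Ccont (fun u => b * dwfun v (f u))%C.
Proof.
  intros H. apply Ccont_mult; [apply Ccont_const|].
  apply Ccont_mult; [|apply wfun_cont; assumption].
  apply Ccont_minus; [apply Ccont_const|apply Ccont_Cexp, H].
Qed.

(* Cauchy's theorem on a parallelogram: exchange the integrals of [zeta * dwfun v (u + t * zeta)]. *)
Lemma wfun_parallelogram (v zeta : C) (N : R) :
  (CInt (fun u => wfun v (u + zeta)) (- N) N - CInt (fun u => wfun v u) (- N) N =
   CInt (fun t => zeta * (wfun v (N + t * zeta) - wfun v (- N + t * zeta))) 0 1)%C.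
Proof.
  assert (Hline : forall a : C, Ccont (fun t => a + t * zeta)%C).
  { intros a. apply Ccont_plus; [apply Ccont_const|].
    apply Ccont_mult; [apply Ccont_id|apply Ccont_const]. }
  assert (Hhor : forall a : C, Ccont (fun u : R => u + a)%C).
  { intros a. apply Ccont_plus; [apply Ccont_id|apply Ccont_const]. }
  rewrite <- CInt_minus.
  2: apply wfun_cont, Hhor.
  2: apply wfun_cont, Ccont_id.
  transitivity (CInt (fun u => CInt (fun t => zeta * dwfun v (u + t * zeta))%C 0 1) (- N) N).
  - apply CInt_ext. intros u.
    rewrite (CInt_derC (fun t => wfun v (u + t * zeta))%C).
    + f_equal; [f_equal; ring|f_equal; f_equal; ring].
    + intros x. apply is_derC_wfun.
    + apply dwfun_cont, Hline.
  (* Integrated in [u] first, the same integrand is [zeta] times a derivative in the horizontal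
     direction, which leaves the two slanted sides. *)
  - rewrite (CInt_swap_order (fun u t => zeta * dwfun v (u + t * zeta))%C).
    + apply CInt_ext. intros t.
      rewrite CInt_scal.
      * f_equal. rewrite (CInt_derC (fun u : R => wfun v (t * zeta + u * 1))%C).
        -- replace (t * zeta + (- N)%R * 1)%C with (- N + t * zeta)%C
             by (rewrite RtoC_opp; ring).
           replace (t * zeta + N * 1)%C with (N + t * zeta)%C by ring. reflexivity.
        -- intros x.
           replace (dwfun v (x + t * zeta)) with (1 * dwfun v (t * zeta + x * 1))%C
             by (rewrite Cmult_1_l; f_equal; ring).
           apply is_derC_wfun.
        -- apply (Ccont_ext (fun x : R => 1 * dwfun v (x + t * zeta))%C); [intros; ring|].
           apply dwfun_cont, Hhor.
      * apply (Ccont_ext (fun x : R => 1 * dwfun v (x + t * zeta))%C); [intros; ring|].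
        apply dwfun_cont, Hhor.
    + apply dwfun_cont2. apply Ccont2_plus; [apply Ccont2_fst, Ccont_id|].
      apply Ccont2_mult; [apply Ccont2_snd, Ccont_id|apply Ccont2_const].
Qed.

Lemma C_eq_small (x y : C) : (forall eps, 0 < eps -> Cmod (x - y) <= eps) -> x = y.
Proof.
  intros H. destruct (Ceq_dec x y) as [|Hne]; [assumption|exfalso].
  assert (Hpos : 0 < Cmod (x - y)) by (apply Cmod_gt_0, Cminus_eq_contra, Hne).
  specialize (H (Cmod (x - y) / 2) ltac:(lra)). lra.
Qed.

Lemma Cmod_wfun (v z : C) :
  Cmod (wfun v z) = exp (Re (v * z)%C - exp (Re z) * cos (Im z)).
Proof. unfold wfun. rewrite Cmod_Cexp. reflexivity. Qed.

Lemma exp_le_compat (x y : R) : x <= y -> exp x <= exp y.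
Proof. intros [H|H]; [left; apply exp_increasing, H|rewrite H; right; reflexivity]. Qed.

Lemma zero_in_strip : Rabs (Im 0%C) < PI / 2.
Proof. simpl; rewrite Rabs_R0; generalize PI_RGT_0; lra. Qed.

(** Uniform in [t], so that it dominates the horizontal sides ([t = 0] and [t = 1]) and also makes
    the slanted sides vanish ([u = N] and [u = - N]). On the segment, [r] bounds the coefficient of
    [- exp u] from below, and [exp c] bounds the extra factor [exp (t Re (v zeta))]. *)
Lemma wfun_segment_bound (v zeta : C) : 0 < Re v -> Rabs (Im zeta) < PI / 2 ->
  exists M, 0 <= M /\ forall t u : R, 0 <= t <= 1 -> Cmod (wfun v (u + t * zeta)) <= M / (1 + u ^ 2).
Proof.
  intros Hv Hz.
  assert (Hcos := cos_pos_of_abs _ Hz).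
  set (r := exp (- Rabs (Re zeta)) * cos (Im zeta)).
  assert (Hr : 0 < r) by (apply Rmult_lt_0_compat; [apply exp_pos|exact Hcos]).
  destruct (exp_double_exp_bound (Re v) r Hv Hr) as [M [HM0 HM]].
  set (c := Rabs (Re (v * zeta)%C)).
  exists (exp c * M). split; [apply Rmult_le_pos; [left; apply exp_pos|exact HM0]|].
  intros t u Ht. rewrite Cmod_wfun.
  apply Rle_trans with (exp c * exp (Re v * u - r * exp u)).
  - rewrite <- exp_plus. apply exp_le_compat.
    assert (E1 : Re (v * (u + t * zeta))%C = Re v * u + t * Re (v * zeta)%C)
      by (simpl; unfold Re, Im; ring).
    assert (E2 : Re (u + t * zeta)%C = u + t * Re zeta) by (simpl; unfold Re, Im; ring).
    assert (E3 : Im (u + t * zeta)%C = t * Im zeta) by (simpl; unfold Re, Im; ring).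
    rewrite E1, E2, E3, exp_plus.
    assert (Hc : t * Re (v * zeta)%C <= c).
    { eapply Rle_trans; [apply Rle_abs|]. rewrite Rabs_mult, (Rabs_pos_eq t) by lra.
      fold c. generalize (Rabs_pos (Re (v * zeta)%C)); fold c; nra. }
    assert (Hexp : exp (- Rabs (Re zeta)) <= exp (t * Re zeta)).
    { apply exp_le_compat.
      assert (Ha := Rle_abs (- (t * Re zeta))).
      rewrite Rabs_Ropp, Rabs_mult, (Rabs_pos_eq t) in Ha by lra.
      generalize (Rabs_pos (Re zeta)). nra. }
    assert (Hcos2 : cos (Im zeta) <= cos (t * Im zeta)).
    { assert (Habs : forall x, cos x = cos (Rabs x)).
      { intros x. unfold Rabs; destruct (Rcase_abs x); [rewrite cos_neg|]; reflexivity. }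
      rewrite (Habs (Im zeta)), (Habs (t * Im zeta)), Rabs_mult, (Rabs_pos_eq t) by lra.
      assert (H0 := Rabs_pos (Im zeta)). assert (HPI := PI_RGT_0).
      apply cos_decr_1; nra. }
    assert (Hrr : r <= exp (t * Re zeta) * cos (t * Im zeta)).
    { apply Rmult_le_compat; [left; apply exp_pos|lra|exact Hexp|exact Hcos2]. }
    generalize (exp_pos u). intros Heu. nra.
  - unfold Rdiv; rewrite Rmult_assoc. apply Rmult_le_compat_l; [left; apply exp_pos|apply HM].
Qed.

(* In the limit, the two sides of the parallelogram that are parallel to [zeta] contribute 0. *)
Lemma gamma_line_rotate (v zeta : C) : 0 < Re v -> Rabs (Im zeta) < PI / 2 ->
  gamma_line v zeta = (Cexp (- (v * zeta)) * gamma_line v 0)%C.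
Proof.
  intros Hv Hz.
  assert (H0 := zero_in_strip).
  destruct (wfun_segment_bound v zeta Hv Hz) as [M [HM0 HM]].
  assert (Hhor : forall a : C, Ccont (fun u : R => wfun v (u + a))).
  { intros a. apply wfun_cont.
    apply Ccont_plus; [apply Ccont_id|apply Ccont_const]. }
  assert (D1 : dominated (fun u => wfun v (u + zeta)) M).
  { split; [apply Hhor|]. intros u. specialize (HM 1 u ltac:(lra)).
    rewrite Cmult_1_l in HM. exact HM. }
  assert (D0 : dominated (fun u => wfun v u) M).
  { split; [apply wfun_cont, Ccont_id|].
    intros u. specialize (HM 0 u ltac:(lra)).
    rewrite Cmult_0_l, Cplus_0_r in HM. exact HM. }
  assert (I1 : is_CInt_line (fun u => wfun v (u + zeta)) (Cexp (v * zeta) * gamma_line v zeta)%C).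
  { apply (is_CInt_line_ext (fun u => Cexp (v * zeta) * gamma_kernel v zeta u)%C).
    - intros u; symmetry; apply wfun_shift.
    - apply is_CInt_line_scal; [apply gamma_kernel_cont|apply gamma_line_correct; assumption]. }
  assert (I0 : is_CInt_line (fun u => wfun v u) (gamma_line v 0)).
  { apply (is_CInt_line_ext (gamma_kernel v 0)).
    - intros u; unfold gamma_kernel, wfun; rewrite Cplus_0_r; reflexivity.
    - apply gamma_line_correct; assumption. }
  assert (Hm := Cmod_ge_0 zeta).
  assert (E : (Cexp (v * zeta) * gamma_line v zeta)%C = gamma_line v 0).
  { apply C_eq_small. intros eps Heps.
    (* Half of [eps] is for the tails of the two horizontal integrals, half for the slanted sides,
       which contribute at most [K / (1 + N ^ 2)]. *)
    destruct (mult_atan_tail (2 * M) (eps / 2) ltac:(lra) ltac:(lra)) as [N0 [HN0 HN]].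
    set (K := 2 * M * Cmod zeta).
    assert (HK : 0 <= K) by (unfold K; apply Rmult_le_pos; lra).
    set (N := Rmax N0 (K / (eps / 2))).
    assert (N1 : N0 <= N) by apply Rmax_l. assert (N2 : K / (eps / 2) <= N) by apply Rmax_r.
    specialize (HN N N1).
    assert (T1 := dominated_tail _ _ N _ D1 I1 ltac:(lra)).
    assert (T0 := dominated_tail _ _ N _ D0 I0 ltac:(lra)).
    assert (P := wfun_parallelogram v zeta N).
    assert (HN2 := one_plus_sqr_pos N).
    assert (Hb : Cmod (CInt (fun t => zeta * (wfun v (N + t * zeta) - wfun v (- N + t * zeta)))%C 0 1)
      <= Cmod zeta * (2 * (M / (1 + N ^ 2)))).
    { set (c := Cmod zeta * (2 * (M / (1 + N ^ 2)))).
      replace c with ((1 - 0) * c) by ring; unfold c.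
      apply CInt_le_const; [lra| |].
      - assert (Hl : forall a : C, Ccont (fun t : R => wfun v (a + t * zeta))).
        { intros a. apply wfun_cont. apply Ccont_plus; [apply Ccont_const|].
          apply Ccont_mult; [apply Ccont_id|apply Ccont_const]. }
        apply Ccont_mult; [apply Ccont_const|apply Ccont_minus; apply Hl].
      - intros t Ht. rewrite Cmod_mult. apply Rmult_le_compat_l; [exact Hm|].
        unfold Cminus. eapply Rle_trans; [apply Cmod_triangle|]. rewrite Cmod_opp.
        assert (B1 := HM t N Ht). assert (B2 := HM t (- N) Ht).
        rewrite RtoC_opp in B2. replace ((- N) ^ 2) with (N ^ 2) in B2 by ring. lra. }
    rewrite <- P in Hb.
    set (X := (Cexp (v * zeta) * gamma_line v zeta)%C) in *.
    set (Y := gamma_line v 0) in *.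
    set (x := CInt (fun u => wfun v (u + zeta)) (- N) N) in *.
    set (y := CInt (fun u => wfun v u) (- N) N) in *.
    replace (X - Y)%C with ((X - x) + ((x - y) + - (Y - y)))%C by ring.
    eapply Rle_trans; [apply Cmod_triangle|].
    eapply Rle_trans; [apply Rplus_le_compat_l, Cmod_triangle|]. rewrite Cmod_opp.
    assert (HKb : Cmod zeta * (2 * (M / (1 + N ^ 2))) <= eps / 2).
    { replace (Cmod zeta * (2 * (M / (1 + N ^ 2)))) with (K / (1 + N ^ 2))
        by (unfold K; field; lra).
      apply Rmult_le_reg_r with (1 + N ^ 2); [lra|].
      replace (K / (1 + N ^ 2) * (1 + N ^ 2)) with K by (field; lra).
      replace K with (eps / 2 * (K / (eps / 2))) by (field; lra).
      apply Rmult_le_compat_l; [lra|]. nra. }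
    lra. }
  rewrite <- E, Cmult_assoc, <- Cexp_plus.
  replace (- (v * zeta) + v * zeta)%C with (RtoC 0) by ring.
  rewrite Cexp_0. ring.
Qed.

(** * Exponential decay, functional equation and positivity of Gamma *)

(** Turning the line by a further angle [e] produces the factor [exp (- e Im v)], while the turned
    integral stays bounded on the vertical line. The choices [e = eta] and [e = - eta] handle the
    two signs of [Im v]; [eta] is half the distance to the edge of the strip. *)
Lemma gamma_line_decay (s : R) (zeta : C) : 0 < s -> Rabs (Im zeta) < PI / 2 ->
  exists K eta, 0 <= K /\ 0 < eta /\
    forall v, Re v = s -> Cmod (gamma_line v zeta) <= K * exp (- (eta * Rabs (Im v))).
Proof.
  intros Hs Hz.
  set (eta := (PI / 2 - Rabs (Im zeta)) / 2).
  assert (Heta : 0 < eta) by (unfold eta; lra).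
  assert (Hshift : forall e, Rabs e <= eta -> Rabs (Im (zeta + Ci * e)%C) < PI / 2).
  { intros e He. replace (Im (zeta + Ci * e)%C) with (Im zeta + e) by (simpl; unfold Im; ring).
    eapply Rle_lt_trans; [apply Rabs_triang|]. unfold eta in He. lra. }
  assert (Hone : forall e, Rabs e <= eta -> exists K, 0 <= K /\ forall v, Re v = s ->
    Cmod (gamma_line v zeta) <= K * exp (- (e * Im v))).
  { intros e He. specialize (Hshift e He).
    destruct (gamma_kernel_dominated s _ Hs Hshift) as [M HM].
    exists (M * PI). split.
    - apply Rmult_le_pos; [|left; apply PI_RGT_0].
      apply (dominated_pos _ _ (HM s eq_refl)).
    - intros v Hv. assert (Hv0 : 0 < Re v) by (rewrite Hv; exact Hs).
      replace (gamma_line v zeta) with (Cexp (v * (Ci * e)) * gamma_line v (zeta + Ci * e))%C.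
      + rewrite Cmod_mult, Cmod_Cexp, Rmult_comm.
        apply Rmult_le_compat; [apply Cmod_ge_0|left; apply exp_pos| |].
        * apply (dominated_le _ _ _ (HM v Hv)). apply gamma_line_correct; assumption.
        * right; f_equal. simpl; unfold Re, Im; ring.
      + rewrite (gamma_line_rotate v (zeta + Ci * e)), (gamma_line_rotate v zeta) by assumption.
        rewrite Cmult_assoc, <- Cexp_plus. f_equal. f_equal. ring. }
  destruct (Hone eta) as [K1 [HK1 H1]]; [rewrite Rabs_pos_eq; lra|].
  destruct (Hone (- eta)) as [K2 [HK2 H2]]; [rewrite Rabs_left; lra|].
  exists (K1 + K2), eta. split; [lra|split; [exact Heta|]].
  intros v Hv. specialize (H1 v Hv). specialize (H2 v Hv).
  unfold Rabs; destruct (Rcase_abs (Im v)).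
  - replace (- eta * Im v) with (eta * - Im v) in H2 by ring.
    generalize (exp_pos (- (eta * - Im v))); nra.
  - generalize (exp_pos (- (eta * Im v))); nra.
Qed.

Lemma gamma_line_fourier (k : R) (v zeta : C) (t : R) :
  fourier k (gamma_kernel v zeta) t = gamma_line (v + Ci * (k * t)%R) zeta.
Proof.
  unfold fourier, gamma_line. apply CInt_line_ext; intros u.
  rewrite <- Cexp_Ci. unfold gamma_kernel. rewrite <- Cexp_plus. f_equal.
  rewrite !RtoC_mult. ring.
Qed.

(** Integration by parts: the difference of the two integrands is the derivative of [wfun v] along
    the real line, and its boundary values tend to 0. *)
Lemma gamma_line_add1 (v : C) : 0 < Re v -> gamma_line (v + 1) 0 = (v * gamma_line v 0)%C.
Proof.
  intros Hv.
  assert (H0 := zero_in_strip).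
  assert (Hv1 : 0 < Re (v + 1)%C) by (simpl; unfold Re in *; lra).
  destruct (gamma_kernel_dominated (Re v) 0 Hv H0) as [M HM]. specialize (HM v eq_refl).
  assert (HM0 := dominated_pos _ _ HM).
  assert (Hker : forall u : R, (v * gamma_kernel v 0 u - gamma_kernel (v + 1) 0 u)%C = dwfun v u).
  { intros u. unfold dwfun, wfun, gamma_kernel. rewrite Cplus_0_r.
    replace ((v + 1) * u - Cexp u)%C with ((v * u - Cexp u) + u)%C by ring.
    rewrite (Cexp_plus (v * u - Cexp u)). ring. }
  assert (Hk0 : forall u : R, wfun v u = gamma_kernel v 0 u).
  { intros u; unfold wfun, gamma_kernel; rewrite Cplus_0_r; reflexivity. }
  assert (Hd : Ccont (fun u => dwfun v u)).
  { apply (Ccont_ext (fun u => 1 * dwfun v u)%C); [intros; ring|].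
    apply dwfun_cont, Ccont_id. }
  assert (I : is_CInt_line (fun u => dwfun v u) (v * gamma_line v 0 - gamma_line (v + 1) 0)%C).
  { apply (is_CInt_line_ext (fun u => v * gamma_kernel v 0 u - gamma_kernel (v + 1) 0 u)%C);
      [exact Hker|].
    apply is_CInt_line_minus; [apply is_CInt_line_scal; [apply gamma_kernel_cont|]|];
      apply gamma_line_correct; assumption. }
  symmetry. apply C_eq_small. intros eps Heps.
  set (X := (v * gamma_line v 0 - gamma_line (v + 1) 0)%C) in *.
  replace X with (X - 0)%C by ring.
  (* Beyond [2 * M / eps] each boundary value is at most [eps / 2], because
     [1 + x ^ 2 >= Rabs x]. *)
  apply (Cmod_lim_le _ X 0 eps (2 * M / eps) Hd I).
  intros a b Ha Hb.
  rewrite (CInt_derC (fun u => wfun v u)).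
  2:{ intros x. assert (H := is_derC_wfun v 0 1 x).
      replace (dwfun v x) with (1 * ((v - Cexp (0 + x * 1)) * wfun v (0 + x * 1)))%C.
      - eapply is_derC_ext; [|exact H]. intros; simpl. f_equal. ring.
      - unfold dwfun. replace (0 + x * 1)%C with (RtoC x) by ring. ring. }
  2: exact Hd.
  rewrite !Hk0.
  replace (gamma_kernel v 0 b - gamma_kernel v 0 a - 0)%C
    with (gamma_kernel v 0 b + - gamma_kernel v 0 a)%C by ring.
  eapply Rle_trans; [apply Cmod_triangle|]. rewrite Cmod_opp.
  assert (Hsmall : forall x, 2 * M / eps <= Rabs x -> Cmod (gamma_kernel v 0 x) <= eps / 2).
  { intros x Hx. eapply Rle_trans; [apply HM|].
    assert (Hx2 := one_plus_sqr_pos x).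
    apply Rmult_le_reg_r with (1 + x ^ 2); [lra|].
    replace (M / (1 + x ^ 2) * (1 + x ^ 2)) with M by (field; lra).
    replace M with (eps / 2 * (2 * M / eps)) at 1 by (field; lra).
    apply Rmult_le_compat_l; [lra|]. rewrite <- pow2_abs. nra. }
  assert (Hpos : 0 <= 2 * M / eps) by (apply Rmult_le_pos; [lra|left; apply Rinv_0_lt_compat; lra]).
  assert (S1 := Hsmall b ltac:(rewrite Rabs_pos_eq; lra)).
  assert (S2 := Hsmall a ltac:(rewrite Rabs_left1; lra)). lra.
Qed.

Lemma is_CInt_line_Re_ge (f : R -> C) (l : C) (a b : R) : Ccont f -> is_CInt_line f l ->
  (forall u, 0 <= Re (f u)) -> a <= b -> Re (CInt f a b) <= Re l.
Proof.
  intros Hf Hl Hpos Hab. apply Rnot_lt_le; intros Hlt.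
  destruct (proj1 (is_CInt_line_iff f l Hf) Hl (Re (CInt f a b) - Re l)) as [N [HN0 HN]]; [lra|].
  set (a' := Rmin a (- N)). set (b' := Rmax b N).
  assert (A1 : a' <= a) by apply Rmin_l. assert (A2 : a' <= - N) by apply Rmin_r.
  assert (B1 : b <= b') by apply Rmax_l. assert (B2 : N <= b') by apply Rmax_r.
  specialize (HN a' b' A2 B2). apply Cmod_lt_Re_Im in HN. destruct HN as [HN _].
  rewrite <- (CInt_Chasles f a' a b'), <- (CInt_Chasles f a b b') in HN by exact Hf.
  assert (Hge : forall c d, c <= d -> 0 <= Re (CInt f c d)).
  { intros c d Hcd. apply (RInt_ge_0 (fun t => Re (f t))); [exact Hcd|apply ex_RInt_Re, Hf|].
    intros; apply Hpos. }
  assert (G1 := Hge _ _ A1). assert (G2 := Hge _ _ B1).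
  apply Rabs_def2 in HN. unfold Re in *. simpl in *. lra.
Qed.

Lemma gamma_kernel_RtoC (s u : R) : gamma_kernel s 0 u = RtoC (exp (s * u - exp u)).
Proof.
  unfold gamma_kernel. rewrite Cplus_0_r, Cexp_RtoC, <- RtoC_mult, <- RtoC_minus.
  apply Cexp_RtoC.
Qed.

Lemma gamma_line_real_pos (s : R) : 0 < s -> 0 < Re (gamma_line s 0).
Proof.
  intros Hs.
  assert (H0 := zero_in_strip).
  assert (Hre : forall u, Re (gamma_kernel s 0 u) = exp (s * u - exp u))
    by (intros u; rewrite gamma_kernel_RtoC; reflexivity).
  apply Rlt_le_trans with (Re (CInt (gamma_kernel s 0) 0 1)).
  - apply (RInt_gt_0 (fun t => Re (gamma_kernel s 0 t))); [lra| |].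
    + intros; rewrite Hre; apply exp_pos.
    + intros x _. apply (proj1 (gamma_kernel_cont s 0 x)).
  - apply is_CInt_line_Re_ge; [apply gamma_kernel_cont|apply gamma_line_correct; assumption| |lra].
    intros u; rewrite Hre; left; apply exp_pos.
Qed.

Lemma cosh_ge_quadratic (x : R) : x ^ 2 <= 4 * (exp x + exp (- x) - 2).
Proof.
  assert (H : forall y, 0 <= y -> y ^ 2 <= 4 * (exp y + exp (- y) - 2)).
  { intros y Hy. assert (H1 := exp_ge_quadratic y Hy).
    generalize (exp_ineq1_le (- y)). lra. }
  destruct (Rle_dec 0 x) as [Hx|Hx]; [apply H, Hx|].
  specialize (H (- x) ltac:(lra)). rewrite Ropp_involutive in H.
  replace ((- x) ^ 2) with (x ^ 2) in H by ring. lra.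
Qed.

Lemma cos_ge_quadratic (x : R) : 1 - x ^ 2 / 2 <= cos x.
Proof.
  assert (Hs : forall z, 0 <= z -> sin z ^ 2 <= z ^ 2).
  { intros z Hz. destruct (Rle_dec z 1) as [H1|H1].
    - assert (0 <= sin z) by (apply sin_ge_0; generalize PI2_3_2; unfold PI2; lra).
      assert (sin z <= z).
      { destruct Hz as [Hz|<-]; [left; apply sin_lt_x, Hz|rewrite sin_0; lra]. }
      nra.
    - generalize (SIN_bound z). nra. }
  assert (Hc : forall y, 0 <= y -> 1 - y ^ 2 / 2 <= cos y).
  { intros y Hy. replace y with (2 * (y / 2)) at 2 by field. rewrite cos_2a_sin.
    specialize (Hs (y / 2) ltac:(lra)). nra. }
  destruct (Rle_dec 0 x) as [Hx|Hx]; [apply Hc, Hx|].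
  specialize (Hc (- x) ltac:(lra)). rewrite cos_neg in Hc.
  replace ((- x) ^ 2) with (x ^ 2) in Hc by ring. exact Hc.
Qed.

(** * Non-vanishing of the Gamma function *)

(* The mass of [exp (s u - exp u)] concentrates near [u = ln s], so the factor [exp (i y (u - ln s))]
   has little effect: [1 - cos x <= x^2 / 2], and [(u - ln s)^2] is bounded by exponentials whose
   integrals are [Gamma(s)], [Gamma(s + 1)] and [Gamma(s - 1)]. *)
Lemma gamma_line_neq_0_large (s y : R) : 1 < s -> 2 * y ^ 2 < s - 1 ->
  gamma_line (s, y) 0 <> 0.
Proof.
  intros Hs Hy E.
  assert (Hz := zero_in_strip).
  set (l := ln s). assert (Hel : exp l = s) by (apply exp_ln; lra).
  (* With [x = u - l], the two quadratic bounds give [cos (y x) >= 1 + 4 y^2 - 2 y^2 (exp x + exp (-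
     x))]. Multiplied by [exp (s u - exp u)], the difference of the two sides is [Re (F u)]: [exp x]
     and [exp (- x)] shift [s] by 1 up and down, with the factors [1 / s] and [s] because
     [exp l = s]. *)
  set (F := fun u => (cis (- y * l) * gamma_kernel (s, y) 0 u
    - (RtoC (1 + 4 * y ^ 2) * gamma_kernel s 0 u -
       (RtoC (2 * y ^ 2 / s) * gamma_kernel (RtoC s + 1) 0 u
        + RtoC (2 * y ^ 2 * s) * gamma_kernel (RtoC (s - 1)) 0 u)))%C).
  set (G := (cis (- y * l) * gamma_line (s, y) 0
    - (RtoC (1 + 4 * y ^ 2) * gamma_line s 0 -
       (RtoC (2 * y ^ 2 / s) * gamma_line (RtoC s + 1) 0
        + RtoC (2 * y ^ 2 * s) * gamma_line (RtoC (s - 1)) 0)))%C).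
  assert (Hcs : forall c v, Ccont (fun u => c * gamma_kernel v 0 u)%C).
  { intros c v. apply Ccont_mult; [apply Ccont_const|apply gamma_kernel_cont]. }
  assert (HF : Ccont F).
  { apply Ccont_minus; [apply Hcs|]. apply Ccont_minus; [apply Hcs|].
    apply Ccont_plus; apply Hcs. }
  assert (Hint : is_CInt_line F G).
  { assert (Hsc : forall c v, 0 < Re v ->
      is_CInt_line (fun u => c * gamma_kernel v 0 u)%C (c * gamma_line v 0)%C).
    { intros c v Hv. apply is_CInt_line_scal; [apply gamma_kernel_cont|].
      apply gamma_line_correct; assumption. }
    unfold F, G. apply is_CInt_line_minus; [apply Hsc; simpl; lra|].
    apply is_CInt_line_minus; [apply Hsc; simpl; lra|].
    apply is_CInt_line_plus; apply Hsc; simpl; lra. }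
  assert (Hpos : forall u, 0 <= Re (F u)).
  { intros u. unfold F.
    replace (RtoC s + 1)%C with (RtoC (s + 1)) by (rewrite RtoC_plus; reflexivity).
    rewrite !gamma_kernel_RtoC.
    assert (Hk : (cis (- y * l) * gamma_kernel (s, y) 0 u)%C =
      (RtoC (exp (s * u - exp u)) * cis (y * (u - l)))%C).
    { rewrite <- !Cexp_Ci, <- Cexp_RtoC, <- Cexp_plus. unfold gamma_kernel.
      rewrite <- Cexp_plus. f_equal. rewrite Cplus_0_r, Cexp_RtoC.
      apply C_eq; simpl; unfold Re, Im; simpl; ring. }
    rewrite Hk.
    assert (E1 : exp ((s + 1) * u - exp u) = exp (s * u - exp u) * (s * exp (u - l))).
    { replace ((s + 1) * u - exp u) with ((s * u - exp u) + (l + (u - l))) by ring.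
      rewrite exp_plus, (exp_plus l), Hel. reflexivity. }
    assert (E2 : exp ((s - 1) * u - exp u) = exp (s * u - exp u) * (exp (- (u - l)) / s)).
    { replace ((s - 1) * u - exp u) with ((s * u - exp u) + (- (u - l) + - l)) by ring.
      rewrite exp_plus, (exp_plus (- (u - l))), (exp_Ropp l), Hel. reflexivity. }
    rewrite E1, E2.
    assert (Hc := cos_ge_quadratic (y * (u - l))).
    assert (Hq := cosh_ge_quadratic (u - l)).
    assert (Hp := exp_pos (s * u - exp u)).
    set (e := exp (s * u - exp u)) in *. set (p := exp (u - l)) in *.
    set (q := exp (- (u - l))) in *. set (x := u - l) in *.
    match goal with |- 0 <= Re ?z =>
      replace (Re z) with (e * (cos (y * x) - (1 + 4 * y ^ 2 - 2 * y ^ 2 * (p + q)))) end.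
    - apply Rmult_le_pos; [lra|].
      assert (y ^ 2 * x ^ 2 <= y ^ 2 * (4 * (p + q - 2)))
        by (apply Rmult_le_compat_l; [apply pow2_ge_0|exact Hq]).
      rewrite Rpow_mult_distr in Hc. lra.
    - simpl; unfold Re, Im; simpl; field; lra. }
  assert (H := is_CInt_line_Re_ge F G 0 0 HF Hint Hpos (Rle_refl 0)).
  replace (Re (CInt F 0 0)) with 0 in H
    by (symmetry; exact (RInt_point (V := R_CompleteNormedModule) 0 _)).
  unfold G in H. rewrite E in H.
  (* The functional equation expresses the remaining terms through [Gamma(s - 1)]; they add up to
     [- (s - 1 - 2 y^2) Gamma(s - 1)], whose real part is negative, although it is the integral of a
     nonnegative function. *)
  set (g := gamma_line (RtoC (s - 1)) 0) in *.
  assert (Hg : 0 < Re g) by (apply gamma_line_real_pos; lra).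
  assert (R1 : gamma_line s 0 = (RtoC (s - 1) * g)%C).
  { unfold g. rewrite <- gamma_line_add1 by (simpl; lra). f_equal.
    apply C_eq; simpl; ring. }
  assert (R2 : gamma_line (RtoC s + 1) 0 = (RtoC s * (RtoC (s - 1) * g))%C).
  { rewrite gamma_line_add1 by (simpl; lra). rewrite R1. reflexivity. }
  rewrite R1, R2 in H.
  match type of H with 0 <= Re ?z =>
    replace (Re z) with (- (s - 1 - 2 * y ^ 2) * Re g) in H end.
  - nra.
  - simpl; unfold Re, Im; simpl; field; lra.
Qed.

(** By the functional equation a zero at [v] propagates to every [v + n]. The imaginary part stays
    fixed, so [n > 1 + 2 (Im v)^2] contradicts the estimate for large real part. *)
Lemma gamma_line_neq_0 (v : C) : 0 < Re v -> gamma_line v 0 <> 0.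
Proof.
  intros Hv E.
  assert (Hn : forall n : nat, gamma_line (v + INR n) 0 = 0).
  { induction n as [|n IH].
    - simpl. rewrite Cplus_0_r. exact E.
    - replace (v + INR (S n))%C with (v + INR n + 1)%C
        by (rewrite S_INR, RtoC_plus; ring).
      rewrite gamma_line_add1; [rewrite IH; ring|].
      simpl. generalize (pos_INR n). unfold Re in *. lra. }
  destruct (INR_unbounded (1 + 2 * Im v ^ 2)) as [n Hn1].
  apply (gamma_line_neq_0_large (Re v + INR n) (Im v)).
  - generalize (pow2_ge_0 (Im v)). lra.
  - lra.
  - transitivity (gamma_line (v + INR n) 0); [|apply Hn].
    f_equal. apply C_eq; simpl; unfold Re, Im; ring.
Qed.

(** * The principal logarithm *)

Lemma Carg_pos (t : R) : 0 < t -> Carg t = 0.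
Proof.
  intros Ht. unfold Carg. simpl. destruct (Rle_dec 0 0); [|lra].
  rewrite Cmod_R, Rabs_pos_eq by lra. rewrite Rdiv_diag by lra. apply acos_1.
Qed.

Lemma Clog_pos (t : R) : 0 < t -> Clog t = RtoC (ln t).
Proof.
  intros Ht. unfold Clog. rewrite Carg_pos, Cmod_R, Rabs_pos_eq by lra. reflexivity.
Qed.

Lemma Re_div_Cmod_bound (z : C) : z <> 0 -> -1 <= Re z / Cmod z <= 1.
Proof.
  intros Hz. assert (Hp := proj1 (Cmod_gt_0 z) Hz).
  assert (H := re_le_Cmod z). apply Rabs_le_between in H.
  split; apply Rmult_le_reg_r with (Cmod z); try lra;
    unfold Rdiv; rewrite Rmult_assoc, Rinv_l, Rmult_1_r by lra; lra.
Qed.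

Lemma Cexp_Clog (z : C) : z <> 0 -> Cexp (Clog z) = z.
Proof.
  intros Hz. assert (Hp := proj1 (Cmod_gt_0 z) Hz).
  assert (Hb := Re_div_Cmod_bound z Hz).
  assert (Hs : Cmod z * sqrt (1 - (Re z / Cmod z)²) = Rabs (Im z)).
  { rewrite <- (sqrt_Rsqr (Cmod z)) at 1 by lra.
    rewrite <- sqrt_mult_alt by apply Rle_0_sqr.
    rewrite <- sqrt_Rsqr_abs. f_equal.
    assert (H := Cmod2_alt z). unfold Rsqr. simpl in H.
    replace (Cmod z * Cmod z * (1 - Re z / Cmod z * (Re z / Cmod z)))
      with (Cmod z * Cmod z - Re z * Re z) by (field; lra). lra. }
  unfold Cexp, Clog; simpl. rewrite exp_ln by lra.
  unfold Carg; destruct (Rle_dec 0 (Im z)) as [Hi|Hi].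
  - rewrite cos_acos, sin_acos by assumption.
    apply C_eq; simpl; [field; lra|].
    change (Cmod z * sqrt (1 - (Re z / Cmod z)²) = Im z).
    rewrite Hs. apply Rabs_pos_eq, Hi.
  - rewrite cos_neg, sin_neg, cos_acos, sin_acos by assumption.
    apply C_eq; simpl; [field; lra|].
    rewrite <- Ropp_mult_distr_r.
    change (- (Cmod z * sqrt (1 - (Re z / Cmod z)²)) = Im z).
    rewrite Hs, Rabs_left by lra. ring.
Qed.

Lemma Clog_unique (z zeta : C) : Cexp zeta = z -> - PI < Im zeta < PI -> Clog z = zeta.
Proof.
  intros <- Hi. unfold Clog. rewrite Cmod_Cexp, ln_exp.
  assert (Hp := exp_pos (Re zeta)).
  unfold Carg. rewrite Cmod_Cexp. simpl.
  replace (exp (Re zeta) * cos (Im zeta) / exp (Re zeta)) with (cos (Im zeta)) by (field; lra).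
  apply C_eq; simpl; [reflexivity|].
  destruct (Rle_dec 0 (exp (Re zeta) * sin (Im zeta))) as [H|H].
  - apply acos_cos. split; [|lra].
    apply Rnot_lt_le; intros Hlt. assert (sin (Im zeta) < 0) by (apply sin_lt_0_var; lra). nra.
  - rewrite <- cos_neg, acos_cos; [ring|].
    split; [|lra]. apply Rnot_lt_le; intros Hlt.
    apply H. apply Rmult_le_pos; [lra|]. apply sin_ge_0; lra.
Qed.

(** * Euler's integral in the logarithmic variable *)

Lemma C_R_scal (r : R) (z : C) : scal (V := C_R_NormedModule) r z = (RtoC r * z)%C.
Proof.
  destruct z as [x y].
  change ((r * x, r * y) = (r * x - 0 * y, r * y + 0 * x)). f_equal; ring.
Qed.

(** The change of variable [u = ln x] is made on each compact [[a, b]] inside the positive axis; the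
    logarithm carries the filters at 0+ and at infinity to those at the two ends of the line. *)
Lemma CGamma_gamma_line (v : C) : 0 < Re v -> CGamma v = gamma_line v 0.
Proof.
  intros Hv.
  assert (H := gamma_line_correct v 0 Hv zero_in_strip).
  unfold CGamma.
  refine (is_RInt_gen_unique (V := C_R_CompleteNormedModule)
    (Fa := at_right 0) (Fb := Rbar_locally p_infty) _ _ _).
  intros P HP. destruct (H P HP) as [Q1 Q2 HQ HR HQR].
  destruct HQ as [m Hm], HR as [p Hp].
  exists (fun a => 0 < a < exp m) (fun b => exp p < b).
  - exists (mkposreal _ (exp_pos m)). intros y Hy Hy0.
    change (Rabs (y - 0) < exp m) in Hy. apply Rabs_def2 in Hy. lra.
  - exists (exp p); auto.
  - simpl. intros a b Ha Hb. assert (Hb0 : 0 < b) by (generalize (exp_pos p); lra).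
    destruct (HQR (ln a) (ln b)) as [y [Hy1 Hy2]].
    + apply Hm. rewrite <- (ln_exp m). apply ln_increasing; lra.
    + apply Hp. rewrite <- (ln_exp p). apply ln_increasing; [apply exp_pos|lra].
    + exists y. split; [|exact Hy2]. simpl in Hy1.
      rewrite <- (is_RInt_unique (V := C_R_CompleteNormedModule) _ _ _ _ Hy1).
      assert (Hpos : forall x, Rmin a b <= x <= Rmax a b -> 0 < x).
      { intros x Hx. apply Rlt_le_trans with (Rmin a b); [apply Rmin_glb_lt; lra|lra]. }
      apply (is_RInt_ext (V := C_R_NormedModule)
        (fun x => scal (/ x) (gamma_kernel v 0 (ln x)) : C_R_NormedModule)).
      * intros x Hx. assert (Hx0 : 0 < x) by (apply Hpos; lra).
        unfold Cpower. rewrite Clog_pos by exact Hx0.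
        rewrite <- Cexp_RtoC, <- Cexp_plus.
        transitivity (RtoC (/ x) * gamma_kernel v 0 (ln x))%C.
        { apply C_R_scal. }
        rewrite <- (exp_ln x Hx0) at 1. rewrite <- exp_Ropp, <- Cexp_RtoC.
        unfold gamma_kernel. rewrite <- Cexp_plus. f_equal.
        rewrite Cplus_0_r, Cexp_RtoC, exp_ln by exact Hx0.
        rewrite !RtoC_opp. ring.
      * apply (is_RInt_comp (V := C_R_CompleteNormedModule) (gamma_kernel v 0) ln Rinv a b).
        -- intros x _. apply (Ccont_continuous (gamma_kernel v 0)), gamma_kernel_cont.
        -- intros x Hx. specialize (Hpos x Hx). split.
           ++ auto_derive; [exact Hpos|field; lra].
           ++ apply (ex_derive_continuous (K := R_AbsRing) (V := R_NormedModule)).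
              auto_derive; lra.
Qed.

Definition abel (d t : R) : C := RtoC (exp (- (d * Rabs t))).
(** The Fourier transform of [abel d]; it is not normalised, its total mass being [2 * PI]. *)
Definition poisson (d u : R) : R := 2 * d / (d ^ 2 + u ^ 2).

(** * Abel summation and Mellin inversion *)

Lemma poisson_den_pos (d u : R) : 0 < d -> 0 < d ^ 2 + u ^ 2.
Proof. intros Hd. generalize (pow2_ge_0 u); assert (0 < d ^ 2) by (apply pow_lt; lra); lra. Qed.

Lemma abel_dominated (d : R) : 0 < d -> dominated (abel d) (1 + 4 / d ^ 2).
Proof.
  intros Hd. split.
  - apply Ccont_RtoC. intros x.
    apply (continuous_comp (fun t => - (d * Rabs t)) exp).
    + apply (continuous_opp (V := R_NormedModule)).
      apply (continuous_mult (K := R_AbsRing)); [apply continuous_const|apply continuous_Rabs].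
    + apply continuity_pt_filterlim, derivable_continuous_pt, derivable_pt_exp.
  - intros t. unfold abel. rewrite Cmod_R, Rabs_pos_eq by (left; apply exp_pos).
    apply exp_neg_abs_bound, Hd.
Qed.

Lemma CInt_Cexp_linear (c : C) (a b : R) : c <> 0 ->
  CInt (fun t => Cexp (t * c)) a b = ((Cexp (b * c) - Cexp (a * c)) / c)%C.
Proof.
  intros Hc.
  assert (Hlin : Ccont (fun t => Cexp (t * c))).
  { apply Ccont_Cexp, Ccont_mult; [apply Ccont_id|apply Ccont_const]. }
  assert (E : (c * CInt (fun t => Cexp (t * c)) a b)%C = (Cexp (b * c) - Cexp (a * c))%C).
  { rewrite <- CInt_scal by exact Hlin.
    apply (CInt_derC (fun t => Cexp (t * c))).
    - intros x. apply is_derC_Cexp.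
      apply (is_derC_ext (fun t => 0 + t * c)%C); [intros; ring|apply is_derC_affine].
    - apply Ccont_mult; [apply Ccont_const|exact Hlin]. }
  rewrite <- E. field. exact Hc.
Qed.

Lemma fourier_abel (d u : R) : 0 < d -> fourier 1 (abel d) u = poisson d u.
Proof.
  (* The integrand is [exp (t c)] on the right half-line and [exp (t c')] on the left one, so the
     value is [1 / c' - 1 / c]. *)
  intros Hd. set (c := (- d, u) : C). set (c' := (d, u) : C).
  assert (Hlow : forall z : C, Rabs (Re z) = d -> z <> 0 /\ d <= Cmod z).
  { intros z Hz. assert (H := re_le_Cmod z). rewrite Hz in H. split; [|exact H].
    apply Cmod_gt_0. lra. }
  assert (Hc : c <> 0 /\ d <= Cmod c).
  { apply Hlow. unfold c; simpl. rewrite Rabs_left; lra. }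
  assert (Hc' : c' <> 0 /\ d <= Cmod c').
  { apply Hlow. unfold c'; simpl. rewrite Rabs_pos_eq; lra. }
  destruct Hc as [Hc0 Hc1], Hc' as [Hc0' Hc1'].
  assert (Hdom : dominated (fun t => abel d t * cis (1 * u * t))%C (1 + 4 / d ^ 2))
    by (apply dominated_cis, abel_dominated, Hd).
  apply is_CInt_line_unique, is_CInt_line_iff; [apply Hdom|].
  intros eps Heps.
  assert (Hden : 0 < d * d * eps) by (apply Rmult_lt_0_compat; [apply Rmult_lt_0_compat|]; assumption).
  (* Each endpoint leaves at most [exp (- d N) / d], which [exp (d N) >= 1 + d N] makes smaller than
     [eps / 2]. *)
  exists (2 / (d * d * eps)).
  assert (HN0 : 0 < 2 / (d * d * eps)) by (apply Rdiv_lt_0_compat; lra).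
  split; [lra|].
  intros a b Ha Hb.
  rewrite <- (CInt_Chasles _ a 0 b) by apply Hdom.
  assert (E1 : CInt (fun t => abel d t * cis (1 * u * t))%C a 0 = CInt (fun t => Cexp (t * c')) a 0).
  { unfold CInt; f_equal; apply RInt_ext; intros t Ht; rewrite Rmin_left, Rmax_right in Ht by lra;
      unfold abel; rewrite <- Cexp_Ci, <- Cexp_RtoC, <- Cexp_plus, Rabs_left by lra;
      f_equal; f_equal; unfold c'; apply C_eq; simpl; ring. }
  assert (E2 : CInt (fun t => abel d t * cis (1 * u * t))%C 0 b = CInt (fun t => Cexp (t * c)) 0 b).
  { unfold CInt; f_equal; apply RInt_ext; intros t Ht; rewrite Rmin_left, Rmax_right in Ht by lra;
      unfold abel; rewrite <- Cexp_Ci, <- Cexp_RtoC, <- Cexp_plus, Rabs_pos_eq by lra;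
      f_equal; f_equal; unfold c; apply C_eq; simpl; ring. }
  rewrite E1, E2, !CInt_Cexp_linear by assumption.
  rewrite !Cmult_0_l, Cexp_0.
  assert (Hval : RtoC (poisson d u) = (1 / c' - 1 / c)%C).
  { assert (Hdd := poisson_den_pos d u Hd).
    assert (Hprod : (c' * c)%C = RtoC (- (d ^ 2 + u ^ 2))) by (unfold c, c'; apply C_eq; simpl; ring).
    replace (1 / c' - 1 / c)%C with ((c - c') / (c' * c))%C by (field; split; assumption).
    replace (c - c')%C with (RtoC (- (2 * d))) by (unfold c, c'; apply C_eq; simpl; ring).
    rewrite Hprod, <- RtoC_div by lra. f_equal. unfold poisson; field; lra. }
  rewrite Hval.
  replace ((1 - Cexp (a * c')) / c' + (Cexp (b * c) - 1) / c - (1 / c' - 1 / c))%C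
    with (Cexp (b * c) / c + - (Cexp (a * c') / c'))%C by (field; split; assumption).
  eapply Rle_lt_trans; [apply Cmod_triangle|].
  rewrite Cmod_opp, !Cmod_div, !Cmod_Cexp by assumption.
  replace (Re (b * c)%C) with (- (d * b)) by (unfold c; simpl; ring).
  replace (Re (a * c')%C) with (- (d * - a)) by (unfold c'; simpl; ring).
  assert (Hs : forall x m, 2 / (d * d * eps) <= x -> d <= m -> exp (- (d * x)) / m < eps / 2).
  { intros x m Hx Hm.
    assert (Hdx : 2 / (d * eps) <= d * x).
    { replace (2 / (d * eps)) with (d * (2 / (d * d * eps))) by (field; lra).
      apply Rmult_le_compat_l; lra. }
    assert (He := exp_ineq1_le (d * x)).
    assert (Hde : 0 < d * eps) by (apply Rmult_lt_0_compat; lra).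
    assert (Hq : 0 < 2 / (d * eps)) by (apply Rdiv_lt_0_compat; lra).
    rewrite exp_Ropp.
    apply Rle_lt_trans with (/ exp (d * x) / d).
    - apply Rmult_le_compat_l; [left; apply Rinv_0_lt_compat; lra|].
      apply Rinv_le_contravar; lra.
    - apply Rmult_lt_reg_r with (exp (d * x) * d); [apply Rmult_lt_0_compat; lra|].
      replace (/ exp (d * x) / d * (exp (d * x) * d)) with 1 by (field; lra).
      replace (eps / 2 * (exp (d * x) * d)) with (d * eps / 2 * exp (d * x)) by field.
      replace 1 with (d * eps / 2 * (2 / (d * eps))) by (field; lra).
      apply Rmult_lt_compat_l; lra. }
  assert (S1 := Hs b (Cmod c) Hb Hc1). assert (S2 := Hs (- a) (Cmod c') ltac:(lra) Hc1'). lra.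
Qed.

Lemma is_RInt_poisson (d a b : R) : 0 < d ->
  is_RInt (poisson d) a b (2 * (atan (b / d) - atan (a / d))).
Proof.
  intros Hd.
  replace (2 * (atan (b / d) - atan (a / d))) with (minus (2 * atan (b / d)) (2 * atan (a / d)))
    by (unfold minus, plus, opp; simpl; ring).
  apply (is_RInt_derive (V := R_CompleteNormedModule) (fun u => 2 * atan (u / d))).
  - intros x _. unfold poisson. assert (H := poisson_den_pos d x Hd).
    auto_derive; [trivial|]. unfold Rsqr. field. repeat split; simpl in H; nra.
  - intros x _. apply (ex_derive_continuous (K := R_AbsRing) (V := R_NormedModule)).
    unfold poisson. assert (H := poisson_den_pos d x Hd). auto_derive. simpl in *; lra.
Qed.

Lemma poisson_nonneg (d u : R) : 0 < d -> 0 <= poisson d u.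
Proof.
  intros Hd. apply Rmult_le_pos; [lra|left; apply Rinv_0_lt_compat, poisson_den_pos, Hd].
Qed.

Lemma poisson_cont (d : R) : 0 < d -> Ccont (fun u => RtoC (poisson d u)).
Proof.
  intros Hd. apply Ccont_RtoC. intros x.
  apply (ex_derive_continuous (K := R_AbsRing) (V := R_NormedModule)).
  unfold poisson. assert (H := poisson_den_pos d x Hd). auto_derive. simpl in *; lra.
Qed.

Lemma poisson_bound (d u : R) : 0 < d -> poisson d u <= 2 / d.
Proof.
  intros Hd. unfold poisson. assert (H := poisson_den_pos d u Hd).
  apply Rmult_le_reg_r with (d ^ 2 + u ^ 2); [lra|].
  replace (2 * d / (d ^ 2 + u ^ 2) * (d ^ 2 + u ^ 2)) with (2 / d * d ^ 2) by (field; lra).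
  apply Rmult_le_compat_l; [left; apply Rdiv_lt_0_compat; lra|]. generalize (pow2_ge_0 u); lra.
Qed.

Lemma poisson_mass (d a b : R) : 0 < d -> 2 * (atan (b / d) - atan (a / d)) <= 2 * PI.
Proof. generalize (atan_bound (a / d)), (atan_bound (b / d)); lra. Qed.

Lemma is_CInt_line_poisson (d : R) : 0 < d ->
  is_CInt_line (fun u => RtoC (poisson d u)) (RtoC (2 * PI)).
Proof.
  intros Hd. apply is_CInt_line_iff; [apply poisson_cont, Hd|].
  intros eps Heps.
  destruct (atan_tail (eps / 2) ltac:(lra)) as [N [HN0 HN]].
  exists (d * N). split; [apply Rmult_le_pos; lra|]. intros a b Ha Hb.
  assert (E : CInt (fun u => RtoC (poisson d u)) a b = RtoC (2 * (atan (b / d) - atan (a / d)))).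
  { apply C_eq; simpl.
    - apply is_RInt_unique, is_RInt_poisson, Hd.
    - rewrite (RInt_const (V := R_CompleteNormedModule)). apply Rmult_0_r. }
  rewrite E, <- RtoC_minus, Cmod_R, Rabs_left1.
  - assert (Hb' : N <= b / d) by (apply Rle_div_r; lra).
    assert (Ha' : N <= - (a / d)).
    { apply Rmult_le_reg_r with d; [lra|].
      replace (- (a / d) * d) with (- a) by (field; lra). lra. }
    assert (H1 := HN _ Hb'). assert (H2 := HN _ Ha'). rewrite atan_opp in H2. lra.
  - generalize (poisson_mass d a b Hd). lra.
Qed.

Lemma one_minus_exp_bound (x : R) : 0 <= x -> Rabs (1 - exp (- x)) <= x.
Proof.
  intros Hx. rewrite Rabs_pos_eq.
  - generalize (exp_ineq1_le (- x)). lra.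
  - assert (exp (- x) <= exp 0) by (apply exp_le_compat; lra). rewrite exp_0 in *. lra.
Qed.

(** Continuity gives [e] near 0; away from 0, [u ^ 2 / (1 + u ^ 2)] is bounded below and [K] lifts
    it above [2 * M]. This weight is chosen because its product with [poisson d] is at most
    [2 * d / (1 + u ^ 2)], of integral O(d). *)
Lemma modulus_at_0 (h : R -> C) (M e : R) : dominated h M -> 0 < e ->
  exists K, 0 <= K /\ forall u, Cmod (h u - h 0) <= e + K * (u ^ 2 / (1 + u ^ 2)).
Proof.
  intros [Hc Hb] He.
  assert (HM := dominated_pos h M (conj Hc Hb)).
  assert (Hc0 := proj1 (filterlim_locally _ _) (Ccont_continuous h 0 Hc)).
  destruct (Hc0 (mkposreal (e / 2) ltac:(lra))) as [eta Heta].
  assert (Heta0 := cond_pos eta).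
  assert (Hpos : 0 <= 2 * M * ((1 + eta ^ 2) / eta ^ 2)).
  { apply Rmult_le_pos; [lra|]. apply Rmult_le_pos; [generalize (pow2_ge_0 eta); lra|].
    left; apply Rinv_0_lt_compat, pow_lt, Heta0. }
  exists (2 * M * ((1 + eta ^ 2) / eta ^ 2)). split; [exact Hpos|].
  intros u. assert (Hu := one_plus_sqr_pos u).
  destruct (Rlt_dec (Rabs u) eta) as [Hlt|Hge].
  - assert (Hball : ball (M := R_UniformSpace) 0 eta u) 
      by (change (Rabs (u - 0) < eta); rewrite Rminus_0_r; exact Hlt).
    destruct (Heta u Hball) as [H1 H2].
    change (Rabs (Re (h u) - Re (h 0)) < e / 2) in H1.
    change (Rabs (Im (h u) - Im (h 0)) < e / 2) in H2.
    assert (H := Cmod_le_Re_Im (h u - h 0)%C).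
    change (Cmod (h u - h 0) <= Rabs (Re (h u) - Re (h 0)) + Rabs (Im (h u) - Im (h 0))) in H.
    assert (0 <= u ^ 2 / (1 + u ^ 2))
      by (apply Rmult_le_pos; [apply pow2_ge_0|left; apply Rinv_0_lt_compat; lra]).
    assert (0 <= 2 * M * ((1 + eta ^ 2) / eta ^ 2) * (u ^ 2 / (1 + u ^ 2)))
      by (apply Rmult_le_pos; assumption).
    lra.
  - assert (Hle : forall v, Cmod (h v) <= M).
    { intros v. eapply Rle_trans; [apply Hb|].
      assert (Hv := one_plus_sqr_pos v). apply Rmult_le_reg_r with (1 + v ^ 2); [lra|].
      replace (M / (1 + v ^ 2) * (1 + v ^ 2)) with M by (field; lra).
      generalize (pow2_ge_0 v); nra. }
    apply Rle_trans with (2 * M).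
    + unfold Cminus. eapply Rle_trans; [apply Cmod_triangle|]. rewrite Cmod_opp.
      generalize (Hle u), (Hle 0). lra.
    + assert (Hsq : eta ^ 2 <= u ^ 2) by (rewrite <- (pow2_abs u); apply pow_incr; lra).
      assert (He2 : 0 < eta ^ 2) by (apply pow_lt, Heta0).
      assert (Hone : 1 <= (1 + eta ^ 2) / eta ^ 2 * (u ^ 2 / (1 + u ^ 2))).
      { apply Rmult_le_reg_r with (eta ^ 2 * (1 + u ^ 2)); [apply Rmult_lt_0_compat; lra|].
        replace ((1 + eta ^ 2) / eta ^ 2 * (u ^ 2 / (1 + u ^ 2)) * (eta ^ 2 * (1 + u ^ 2)))
          with ((1 + eta ^ 2) * u ^ 2) by (field; lra). nra. }
      nra.
Qed.

(* Abel summation of the inverse Fourier integral: the multiplication formula turns the weight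
   [exp (- d |t|)] into the Poisson kernel, an approximate identity as [d] tends to 0. *)
Lemma fourier_inversion_at_0 (h : R -> C) (M M1 M2 : R) : dominated h M ->
  dominated (fourier 1 h) M1 ->
  (forall t, Rabs t * Cmod (fourier 1 h t) <= M2 / (1 + t ^ 2)) ->
  CInt_line (fourier 1 h) = (RtoC (2 * PI) * h 0)%C.
Proof.
  intros Hh Hf Hf2. assert (HPI := PI_RGT_0).
  assert (HM2 : 0 <= M2).
  { specialize (Hf2 0). rewrite Rabs_R0, Rmult_0_l in Hf2.
    replace (M2 / (1 + 0 ^ 2)) with M2 in Hf2 by field. exact Hf2. }
  apply C_eq_small. intros eps Heps.
  set (e := eps / (4 * PI)).
  assert (He : 0 < e) by (apply Rdiv_lt_0_compat; lra).
  destruct (modulus_at_0 h M e Hh He) as [K [HK0 HK]].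
  (* The errors are [d M2 PI] (removing the weight), [2 d K PI] (far from 0) and [2 PI e = eps / 2]
     (near 0); [d q = eps / 2] covers the first two, and the [+ 1] keeps [q] positive. *)
  set (q := M2 * PI + 2 * K * PI + 1).
  assert (Hq : 0 < q).
  { unfold q. assert (0 <= M2 * PI) by (apply Rmult_le_pos; lra).
    assert (0 <= 2 * K * PI) by (apply Rmult_le_pos; lra). lra. }
  set (d := eps / 2 / q). assert (Hd : 0 < d) by (apply Rdiv_lt_0_compat; lra).
  assert (HA := abel_dominated d Hd).
  assert (Habs : forall t, Cmod (abel d t) <= 1).
  { intros t. unfold abel. rewrite Cmod_R, Rabs_pos_eq by (left; apply exp_pos).
    rewrite <- exp_0. apply exp_le_compat. generalize (Rabs_pos t). nra. }
  assert (D1 : dominated (fun t => fourier 1 h t * abel d t)%C (M1 * 1))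
    by (apply dominated_mult_bounded; [exact Hf|apply HA|exact Habs]).
  assert (I1 := dominated_correct _ _ D1). assert (I0 := dominated_correct _ _ Hf).
  (* Since [1 - exp (- d |t|) <= d |t|], the bound on [|t|] times the transform makes the effect of
     the weight linear in [d]. *)
  assert (Dd : dominated (fun t => fourier 1 h t - fourier 1 h t * abel d t)%C (d * M2)).
  { split.
    - apply Ccont_minus; [apply Hf|apply D1].
    - intros t.
      replace (fourier 1 h t - fourier 1 h t * abel d t)%C
        with (RtoC (1 - exp (- (d * Rabs t))) * fourier 1 h t)%C
        by (unfold abel; rewrite RtoC_minus; ring).
      rewrite Cmod_mult, Cmod_R.
      assert (H := one_minus_exp_bound (d * Rabs t) ltac:(apply Rmult_le_pos; [lra|apply Rabs_pos])).
      apply Rle_trans with (d * Rabs t * Cmod (fourier 1 h t)).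
      + apply Rmult_le_compat_r; [apply Cmod_ge_0|exact H].
      + unfold Rdiv. rewrite !Rmult_assoc. apply Rmult_le_compat_l; [lra|apply Hf2]. }
  assert (B1 := dominated_le _ _ _ Dd (is_CInt_line_minus _ _ _ _ I0 I1)).
  assert (D2 : dominated (fun u => h u * poisson d u)%C (M * (2 / d))).
  { apply dominated_mult_bounded; [exact Hh|apply poisson_cont, Hd|].
    intros u. rewrite Cmod_R, Rabs_pos_eq by (apply poisson_nonneg, Hd).
    apply poisson_bound, Hd. }
  assert (I2 := dominated_correct _ _ D2).
  assert (E : CInt_line (fun t => fourier 1 h t * abel d t)%C =
    CInt_line (fun u => h u * poisson d u)%C).
  { assert (X := multiplication_formula 1 (abel d) h _ _ HA Hh).
    transitivity (CInt_line (fun t => abel d t * fourier 1 h t)%C).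
    - apply CInt_line_ext; intros; ring.
    - rewrite X. apply CInt_line_ext; intros.
      rewrite fourier_abel by exact Hd. reflexivity. }
  assert (I3 : is_CInt_line (fun u => (h u - h 0) * poisson d u)%C
    (CInt_line (fun u => h u * poisson d u)%C - h 0 * RtoC (2 * PI))%C).
  { apply (is_CInt_line_ext (fun u => h u * poisson d u - h 0 * poisson d u)%C); [intros; ring|].
    apply is_CInt_line_minus; [exact I2|].
    apply is_CInt_line_scal; [apply poisson_cont, Hd|apply is_CInt_line_poisson, Hd]. }
  assert (B2 : Cmod (CInt_line (fun u => h u * poisson d u)%C - h 0 * RtoC (2 * PI))
    <= 2 * PI * e + 2 * d * K * PI).
  { apply (is_CInt_line_le _ (fun u => e * poisson d u + 2 * d * K / (1 + u ^ 2))
      (fun a b => e * (2 * (atan (b / d) - atan (a / d))) + 2 * d * K * (atan b - atan a)) _ _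
      ltac:(apply Ccont_mult; [apply Ccont_minus; [apply Hh|apply Ccont_const]|apply poisson_cont, Hd])
      I3).
    - intros u. rewrite Cmod_mult, Cmod_R, Rabs_pos_eq by (apply poisson_nonneg, Hd).
      apply Rle_trans with ((e + K * (u ^ 2 / (1 + u ^ 2))) * poisson d u).
      + apply Rmult_le_compat_r; [apply poisson_nonneg, Hd|apply HK].
      + rewrite Rmult_plus_distr_r. apply Rplus_le_compat_l.
        assert (Hu := one_plus_sqr_pos u). assert (Hp := poisson_den_pos d u Hd).
        replace (K * (u ^ 2 / (1 + u ^ 2)) * poisson d u)
          with (2 * d * K / (1 + u ^ 2) * (u ^ 2 / (d ^ 2 + u ^ 2)))
          by (unfold poisson; field; lra).
        rewrite <- (Rmult_1_r (2 * d * K / (1 + u ^ 2))) at 2.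
        apply Rmult_le_compat_l.
        * apply Rmult_le_pos; [|left; apply Rinv_0_lt_compat; lra].
          apply Rmult_le_pos; lra.
        * apply Rmult_le_reg_r with (d ^ 2 + u ^ 2); [lra|].
          replace (u ^ 2 / (d ^ 2 + u ^ 2) * (d ^ 2 + u ^ 2)) with (u ^ 2) by (field; lra).
          generalize (pow2_ge_0 d). lra.
    - intros a b Hab. split.
      + apply (is_RInt_plus (V := R_NormedModule)).
        * apply (is_RInt_scal (V := R_NormedModule)), is_RInt_poisson, Hd.
        * apply is_RInt_inv_one_plus_sqr.
      + assert (H1 := poisson_mass d a b Hd).
        assert (H2 : atan b - atan a <= PI) by (generalize (atan_bound a), (atan_bound b); lra).
        assert (0 <= 2 * d * K) by (apply Rmult_le_pos; lra).
        assert (e * (2 * (atan (b / d) - atan (a / d))) <= e * (2 * PI))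
          by (apply Rmult_le_compat_l; lra).
        assert (2 * d * K * (atan b - atan a) <= 2 * d * K * PI)
          by (apply Rmult_le_compat_l; lra).
        lra. }
  rewrite <- E in B2.
  set (X := CInt_line (fourier 1 h)) in *.
  set (Y := CInt_line (fun t => fourier 1 h t * abel d t)%C) in *.
  replace (X - RtoC (2 * PI) * h 0)%C with ((X - Y) + (Y - h 0 * RtoC (2 * PI)))%C by ring.
  eapply Rle_trans; [apply Cmod_triangle|].
  assert (E1 : 2 * PI * e = eps / 2) by (unfold e; field; lra).
  assert (E2 : d * q = eps / 2) by (unfold d; field; lra).
  unfold q in E2. nra.
Qed.

(** * Mellin inversion of Gamma and products of two Gamma factors *)

(** Supplies both decay hypotheses of [fourier_inversion_at_0]. For the second, half of the
    exponential decay absorbs the factor [Rabs t], at the cost of [2 / eta]. *)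
Lemma gamma_line_dominated (s : R) (zeta : C) : 0 < s -> Rabs (Im zeta) < PI / 2 ->
  exists M, dominated (fun t : R => gamma_line (s + Ci * t) zeta) M /\
    forall t : R, Rabs t * Cmod (gamma_line (s + Ci * t) zeta) <= M / (1 + t ^ 2).
Proof.
  intros Hs Hz.
  destruct (gamma_line_decay s zeta Hs Hz) as [K [eta [HK [Heta H]]]].
  destruct (gamma_kernel_dominated s zeta Hs Hz) as [M HM]. specialize (HM s eq_refl).
  assert (Hdec : forall t : R, Cmod (gamma_line (s + Ci * t) zeta) <= K * exp (- (eta * Rabs t))).
  { intros t. specialize (H (s + Ci * t)%C).
    replace (Re (s + Ci * t)%C) with s in H by (simpl; ring).
    replace (Im (s + Ci * t)%C) with t in H by (simpl; ring). apply H; reflexivity. }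
  assert (Hpos : forall e, 0 < e -> 0 < 1 + 4 / e ^ 2).
  { intros e He. assert (0 < 4 / e ^ 2) by (apply Rdiv_lt_0_compat; [lra|apply pow_lt, He]). lra. }
  assert (P1 := Hpos eta Heta). assert (P2 := Hpos (eta / 2) ltac:(lra)).
  assert (P3 : 0 < 2 / eta) by (apply Rdiv_lt_0_compat; lra).
  set (M1 := K * (1 + 4 / eta ^ 2)). set (M2 := K * (2 / eta) * (1 + 4 / (eta / 2) ^ 2)).
  assert (Q1 : 0 <= M1) by (apply Rmult_le_pos; lra).
  assert (Q2 : 0 <= M2) by (apply Rmult_le_pos; [apply Rmult_le_pos|]; lra).
  exists (M1 + M2).
  assert (Hsum : forall t, (M1 + M2) / (1 + t ^ 2) = M1 / (1 + t ^ 2) + M2 / (1 + t ^ 2))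
    by (intros t; field; generalize (one_plus_sqr_pos t); lra).
  assert (Hnn : forall m t, 0 <= m -> 0 <= m / (1 + t ^ 2)).
  { intros m t Hm. apply Rmult_le_pos; [exact Hm|].
    left; apply Rinv_0_lt_compat, one_plus_sqr_pos. }
  split; [split|].
  - apply (Ccont_ext (fourier 1 (gamma_kernel s zeta))); [|apply (fourier_cont _ _ _ HM)].
    intros t. rewrite gamma_line_fourier, Rmult_1_l. reflexivity.
  - intros t. rewrite Hsum.
    assert (Cmod (gamma_line (s + Ci * t) zeta) <= M1 / (1 + t ^ 2)).
    { eapply Rle_trans; [apply Hdec|]. unfold M1, Rdiv. rewrite Rmult_assoc.
      apply Rmult_le_compat_l; [exact HK|apply exp_neg_abs_bound, Heta]. }
    generalize (Hnn M2 t Q2). lra.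
  - intros t. rewrite Hsum.
    assert (Rabs t * Cmod (gamma_line (s + Ci * t) zeta) <= M2 / (1 + t ^ 2)).
    { apply Rle_trans with (Rabs t * (K * exp (- (eta * Rabs t)))).
      - apply Rmult_le_compat_l; [apply Rabs_pos|apply Hdec].
      - apply Rle_trans with (K * (2 / eta) * exp (- (eta / 2 * Rabs t))).
        + rewrite Rmult_assoc, (Rmult_comm (Rabs t)), Rmult_assoc.
          apply Rmult_le_compat_l; [exact HK|].
          replace (- (eta * Rabs t)) with (- (eta / 2 * Rabs t) + - (eta / 2 * Rabs t)) by field.
          rewrite exp_plus.
          assert (Hx : Rabs t * exp (- (eta / 2 * Rabs t)) <= 2 / eta).
          { rewrite exp_Ropp. assert (He := exp_ineq1_le (eta / 2 * Rabs t)).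
            apply Rmult_le_reg_r with (exp (eta / 2 * Rabs t) * (eta / 2)).
            - apply Rmult_lt_0_compat; [apply exp_pos|lra].
            - replace (Rabs t * / exp (eta / 2 * Rabs t) * (exp (eta / 2 * Rabs t) * (eta / 2)))
                with (eta / 2 * Rabs t) by (field; generalize (exp_pos (eta / 2 * Rabs t)); lra).
              replace (2 / eta * (exp (eta / 2 * Rabs t) * (eta / 2)))
                with (exp (eta / 2 * Rabs t)) by (field; lra). lra. }
          generalize (exp_pos (- (eta / 2 * Rabs t))). nra.
        + unfold M2, Rdiv. rewrite Rmult_assoc. rewrite (Rmult_assoc (K * (2 * / eta))).
          rewrite (Rmult_assoc K).
          apply Rmult_le_compat_l; [exact HK|]. apply Rmult_le_compat_l; [lra|].
          apply (exp_neg_abs_bound (eta / 2)). lra. }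
    generalize (Hnn M1 t Q1). lra.
Qed.

(** Inversion at the single point [u = 0] is enough: any other point is reached by translating
    [zeta] along the real direction, see [gamma_line_translate]. *)
Lemma gamma_line_inversion (s : R) (zeta : C) : 0 < s -> Rabs (Im zeta) < PI / 2 ->
  CInt_line (fun t : R => gamma_line (s + Ci * t) zeta) = (RtoC (2 * PI) * Cexp (- Cexp zeta))%C.
Proof.
  intros Hs Hz.
  destruct (gamma_kernel_dominated s zeta Hs Hz) as [M HM]. specialize (HM s eq_refl).
  destruct (gamma_line_dominated s zeta Hs Hz) as [M1 [H1 H2]].
  assert (E : forall t, fourier 1 (gamma_kernel s zeta) t = gamma_line (s + Ci * t) zeta).
  { intros t. rewrite gamma_line_fourier, Rmult_1_l. reflexivity. }
  transitivity (CInt_line (fourier 1 (gamma_kernel s zeta))).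
  - apply CInt_line_ext; intros t; symmetry; apply E.
  - rewrite (fourier_inversion_at_0 (gamma_kernel s zeta) M M1 M1 HM).
    + f_equal. unfold gamma_kernel. f_equal. rewrite Cplus_0_l. ring.
    + apply (dominated_ext (fun t : R => gamma_line (s + Ci * t) zeta)); [|exact H1].
      intros t; symmetry; apply E.
    + intros t; rewrite E; apply H2.
Qed.

Lemma gamma_line_translate (v zeta : C) (u : R) : 0 < Re v -> Rabs (Im zeta) < PI / 2 ->
  gamma_line v (zeta + u) = (Cexp (- (v * u)) * gamma_line v zeta)%C.
Proof.
  intros Hv Hz.
  rewrite (gamma_line_rotate v zeta), (gamma_line_rotate v (zeta + u)); auto.
  - rewrite Cmult_assoc, <- Cexp_plus. f_equal. f_equal. ring.
  - replace (Im (zeta + u)%C) with (Im zeta) by (simpl; unfold Im; ring). exact Hz.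
Qed.

(** The multiplication formula moves the transform from the kernel of [zeta2] to the Gamma factor of
    [zeta1], where inversion yields [2 PI exp (s u - exp (u + zeta1))]. Its product with the kernel
    at [c - s] has [exp u] multiplied by [exp zeta1 + exp zeta2], so it is a Gamma kernel for the
    logarithm [zeta3] of that sum. *)
Lemma mellin_barnes_gamma_line (s : R) (c zeta1 zeta2 zeta3 : C) :
  0 < s < Re c ->
  Rabs (Im zeta1) < PI / 2 -> Rabs (Im zeta2) < PI / 2 ->
  Rabs (Im zeta3) < PI / 2 -> Cexp zeta3 = (Cexp zeta1 + Cexp zeta2)%C ->
  CInt_line (fun t : R => gamma_line (s + Ci * t) zeta1 * gamma_line (c - (s + Ci * t)) zeta2)%C
  = (RtoC (2 * PI) * gamma_line c zeta3)%C.
Proof.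
  intros [Hs Hc] Hz1 Hz2 Hz3 E3.
  destruct (gamma_line_dominated s zeta1 Hs Hz1) as [M1 [HA _]].
  assert (Hcs : 0 < Re (c - s)%C) by (simpl; unfold Re in *; lra).
  destruct (gamma_kernel_dominated _ zeta2 Hcs Hz2) as [M2 HB]. specialize (HB _ eq_refl).
  assert (X := multiplication_formula (-1) _ _ _ _ HA HB).
  transitivity (CInt_line (fun t : R => gamma_line (s + Ci * t) zeta1 *
    fourier (-1) (gamma_kernel (c - s) zeta2) t)%C).
  { apply CInt_line_ext; intros t.
    rewrite gamma_line_fourier. f_equal. f_equal.
    replace (RtoC (-1 * t)) with (- t)%C by (apply C_eq; simpl; ring). ring. }
  rewrite X.
  transitivity (CInt_line (fun u => RtoC (2 * PI) * gamma_kernel c zeta3 u)%C).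
  { apply CInt_line_ext; intros u.
    assert (F : fourier (-1) (fun t : R => gamma_line (s + Ci * t) zeta1) u =
      (Cexp (s * u) * (RtoC (2 * PI) * Cexp (- Cexp (zeta1 + u))))%C).
    { assert (Hzu : Rabs (Im (zeta1 + u)%C) < PI / 2).
      { replace (Im (zeta1 + u)%C) with (Im zeta1) by (simpl; unfold Im; ring). exact Hz1. }
      rewrite <- (gamma_line_inversion s (zeta1 + u) Hs Hzu).
      destruct (gamma_line_dominated s (zeta1 + u) Hs Hzu) as [M3 [HD _]].
      apply is_CInt_line_unique.
      apply (is_CInt_line_ext (fun t : R => Cexp (s * u) * gamma_line (s + Ci * t) (zeta1 + u))%C).
      - intros t. rewrite gamma_line_translate by (try exact Hz1; simpl; lra).
        rewrite Cmult_assoc, <- Cexp_plus, Cmult_comm. f_equal.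
        rewrite <- Cexp_Ci. f_equal.
        replace (RtoC (-1 * u * t)) with (- (u * t))%C by (apply C_eq; simpl; ring). ring.
      - apply is_CInt_line_scal; [apply HD|]. apply (dominated_correct _ _ HD). }
    rewrite F. unfold gamma_kernel.
    rewrite (Cmult_comm (RtoC (2 * PI)) (Cexp (- Cexp (zeta1 + u)))).
    rewrite !Cmult_assoc, <- !Cexp_plus. rewrite Cmult_comm. f_equal. f_equal.
    rewrite !Cexp_plus, E3. ring. }
  apply is_CInt_line_unique, is_CInt_line_scal; [apply gamma_kernel_cont|].
  apply gamma_line_correct; [lra|exact Hz3].
Qed.

(** * The Mellin-Barnes integral of a power *)

Lemma Carg_right_half_plane (z : C) : 0 < Re z -> Rabs (Carg z) < PI / 2.
Proof.
  intros Hz. assert (HPI := PI_RGT_0).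
  assert (Hm : 0 < Cmod z) by (generalize (Re_le_Cmod z); lra).
  assert (H : 0 <= acos (Re z / Cmod z) < PI / 2).
  { assert (H1 : 0 < Re z / Cmod z) by (apply Rdiv_lt_0_compat; assumption).
    assert (H2 : Re z / Cmod z <= 1).
    { apply Rmult_le_reg_r with (Cmod z); [exact Hm|].
      unfold Rdiv; rewrite Rmult_assoc, Rinv_l by lra. generalize (Re_le_Cmod z); lra. }
    split; [apply acos_bound|].
    apply Rnot_le_lt; intros Hle.
    assert (Hc : cos (acos (Re z / Cmod z)) <= 0).
    { apply cos_le_0; [exact Hle|]. generalize (acos_bound (Re z / Cmod z)); lra. }
    rewrite cos_acos in Hc by lra. lra. }
  unfold Carg. destruct (Rle_dec 0 (Im z)).
  - rewrite Rabs_pos_eq; lra.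
  - rewrite Rabs_Ropp, Rabs_pos_eq; lra.
Qed.

Lemma Cexp_Im_strip_Re_pos (z : C) : Rabs (Im z) < PI / 2 -> 0 < Re (Cexp z).
Proof. intros H. simpl. apply Rmult_lt_0_compat; [apply exp_pos|apply cos_pos_of_abs, H]. Qed.

(* Rotating both [a] and [c] by half of [- arg a] puts them in the right half-plane. *)
Definition half_turn (a : C) : C := (Ci * RtoC (- Carg a / 2))%C.

Lemma half_turn_strip (a : C) (r : R) : - PI < Carg a < PI ->
  Rabs (Im (Clog a + half_turn a)%C) < PI / 2 /\ Rabs (Im (r + half_turn a)%C) < PI / 2.
Proof.
  intros H.
  replace (Im (Clog a + half_turn a)%C) with (Carg a / 2)
    by (unfold half_turn, Clog; simpl; field).
  replace (Im (r + half_turn a)%C) with (- Carg a / 2)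
    by (unfold half_turn; simpl; field).
  split; apply Rabs_def1; lra.
Qed.

Lemma half_turn_sum_Re_pos (a : C) (r : R) : - PI < Carg a < PI ->
  0 < Re (Cexp (Clog a + half_turn a) + Cexp (r + half_turn a))%C.
Proof.
  intros Ha. destruct (half_turn_strip a r Ha) as [S1 S2].
  assert (H1 := Cexp_Im_strip_Re_pos _ S1). assert (H2 := Cexp_Im_strip_Re_pos _ S2).
  unfold Re in *; simpl in *; lra.
Qed.

(** The shifts of the two logarithms by [h = half_turn a] contribute [- v h] and [- (B - v) h];
    their sum [- B h] does not depend on [v], so the rotation costs only a constant factor. *)
Lemma mellin_barnes_factor (a B v : C) (c : R) : 0 < c -> - PI < Carg a < PI ->
  0 < Re v -> 0 < Re (B - v)%C ->
  (Cpower a (- v) * CGamma v * CGamma (B - v) * Cexp (- ((B - v) * ln c)))%C =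
  (Cexp (B * half_turn a) *
    (gamma_line v (Clog a + half_turn a) * gamma_line (B - v) (ln c + half_turn a)))%C.
Proof.
  intros Hc Ha Hv HBv.
  destruct (half_turn_strip a (ln c) Ha) as [S1 S2].
  rewrite !CGamma_gamma_line by assumption.
  rewrite (gamma_line_rotate v _ Hv S1), (gamma_line_rotate (B - v) _ HBv S2).
  unfold Cpower.
  set (h := half_turn a).
  assert (E : (Cexp (- v * Clog a) * Cexp (- ((B - v) * ln c)))%C =
    (Cexp (B * h) * (Cexp (- (v * (Clog a + h))) * Cexp (- ((B - v) * (ln c + h)))))%C).
  { rewrite <- !Cexp_plus. f_equal. ring. }
  transitivity (Cexp (- v * Clog a) * Cexp (- ((B - v) * ln c)) *
    (gamma_line v 0 * gamma_line (B - v) 0))%C; [ring|].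
  rewrite E. ring.
Qed.

Lemma Re_line (s t : R) : Re (s + Ci * t)%C = s.
Proof. simpl; ring. Qed.

Lemma Re_minus_line (B : C) (s t : R) : Re (B - (s + Ci * t))%C = Re B - s.
Proof. simpl; unfold Re; ring. Qed.

(** Principal branches agree here: the rotated sum lies in the right half-plane, so its argument and
    the angle [Carg a / 2] that undoes the rotation are both below [PI / 2] in absolute value, and
    their sum stays off the cut. *)
Lemma Clog_add_pos (a : C) (c : R) : a <> 0 -> - PI < Carg a < PI -> 0 < c ->
  Clog (a + c) = (Clog (Cexp (Clog a + half_turn a) + Cexp (ln c + half_turn a)) - half_turn a)%C.
Proof.
  intros Ha0 Ha Hc.
  destruct (half_turn_strip a (ln c) Ha) as [S1 S2].
  set (w := (Cexp (Clog a + half_turn a) + Cexp (ln c + half_turn a))%C).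
  assert (Hw : 0 < Re w) by exact (half_turn_sum_Re_pos a (ln c) Ha).
  assert (Hw0 : w <> 0) by (intros E; rewrite E in Hw; simpl in Hw; lra).
  apply Clog_unique.
  - unfold Cminus. rewrite Cexp_plus, Cexp_Clog by exact Hw0. unfold w.
    rewrite !Cexp_plus, Cexp_Clog, Cexp_RtoC, exp_ln by assumption.
    rewrite Cexp_opp. field. apply Cexp_neq_0.
  - assert (H := Carg_right_half_plane w Hw). apply Rabs_def2 in H.
    replace (Im (Clog w - half_turn a)%C) with (Carg w + Carg a / 2)
      by (unfold half_turn, Clog; simpl; field).
    lra.
Qed.

(** Only the first factor has to decay; the second is a Fourier transform, hence continuous and
    bounded. *)
Lemma gamma_line_product_dominated (s : R) (B zeta1 zeta2 : C) : 0 < s < Re B ->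
  Rabs (Im zeta1) < PI / 2 -> Rabs (Im zeta2) < PI / 2 ->
  exists M, dominated (fun t : R =>
    gamma_line (s + Ci * t) zeta1 * gamma_line (B - (s + Ci * t)) zeta2)%C M.
Proof.
  intros [Hs HB] S1 S2.
  destruct (gamma_line_dominated s zeta1 Hs S1) as [M1 [HD _]].
  assert (HBs : 0 < Re (B - s)%C) by (simpl; unfold Re in *; lra).
  destruct (gamma_kernel_dominated _ zeta2 HBs S2) as [M2 HM]. specialize (HM _ eq_refl).
  exists (M1 * (M2 * PI)).
  apply (dominated_ext (fun t : R => gamma_line (s + Ci * t) zeta1 *
    fourier (-1) (gamma_kernel (B - s) zeta2) t)%C).
  - intros t. rewrite gamma_line_fourier. f_equal. f_equal.
    replace (RtoC (-1 * t)) with (- t)%C by (apply C_eq; simpl; ring). ring.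
  - apply dominated_mult_bounded; [exact HD|apply (fourier_cont _ _ _ HM)|].
    intros t. apply fourier_bound, HM.
Qed.

(** Transports [mellin_barnes_gamma_line] through the rotation; the constant [exp (B h)] of
    [mellin_barnes_factor] reappears on the right when [Clog (a + c)] is written as [Clog w - h]. *)
Lemma mellin_barnes_power (s c : R) (a B : C) : 0 < s < Re B -> 0 < c ->
  a <> 0 -> - PI < Carg a < PI ->
  CInt_line (fun t : R => Cpower a (- (s + Ci * t)) * CGamma (s + Ci * t)
    * CGamma (B - (s + Ci * t)) * Cexp (- ((B - (s + Ci * t)) * ln c)))%C =
  (RtoC (2 * PI) * CGamma B * Cexp (- (B * Clog (a + c))))%C.
Proof.
  intros Hs Hc Ha0 Ha.
  destruct (half_turn_strip a (ln c) Ha) as [S1 S2].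
  rewrite Clog_add_pos by assumption.
  set (h := half_turn a) in *.
  set (w := (Cexp (Clog a + h) + Cexp (ln c + h))%C).
  assert (Hw : 0 < Re w) by exact (half_turn_sum_Re_pos a (ln c) Ha).
  assert (Hw0 : w <> 0) by (intros E; rewrite E in Hw; simpl in Hw; lra).
  assert (S3 : Rabs (Im (Clog w)) < PI / 2) by exact (Carg_right_half_plane w Hw).
  assert (X := mellin_barnes_gamma_line s B _ _ _ Hs S1 S2 S3 (Cexp_Clog w Hw0)).
  assert (HB : 0 < Re B) by lra.
  rewrite CGamma_gamma_line by exact HB.
  destruct (gamma_line_product_dominated s B _ _ Hs S1 S2) as [M HD].
  transitivity (CInt_line (fun t : R => Cexp (B * h) *
    (gamma_line (s + Ci * t) (Clog a + h) * gamma_line (B - (s + Ci * t)) (ln c + h)))%C).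
  - apply CInt_line_ext. intros t. apply mellin_barnes_factor; try assumption.
    + rewrite Re_line; lra.
    + rewrite Re_minus_line; lra.
  - transitivity (Cexp (B * h) * (RtoC (2 * PI) * gamma_line B (Clog w)))%C.
    + rewrite <- X. apply is_CInt_line_unique, is_CInt_line_scal; [apply HD|].
      exact (dominated_correct _ _ HD).
    + rewrite (gamma_line_rotate B (Clog w) HB S3).
      replace (- (B * (Clog w - h)))%C with (B * h + - (B * Clog w))%C by ring.
      rewrite Cexp_plus. ring.
Qed.

(** * Summation over the Dirichlet series *)

(** Comparison with the integral of [x ^ (- p)]: by the mean value theorem each term after the first
    is at most a difference of values of [x ^ (1 - p) / (p - 1)], and these differences
    telescope. *)
Lemma exp_ln_series (p w : R) : 1 < p -> 0 < w ->
  ex_series (fun k => exp (- p * ln (INR k + w))).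
Proof.
  intros Hp Hw.
  set (f := fun x => exp ((1 - p) * ln x)).
  assert (Hx : forall k, 0 < INR k + w) by (intros k; generalize (pos_INR k); lra).
  assert (Hstep : forall k, exp (- p * ln (INR (S k) + w)) <=
    / (p - 1) * (f (INR k + w) - f (INR (S k) + w))).
  { intros k. rewrite S_INR. set (x := INR k + w). specialize (Hx k). fold x in Hx.
    replace (INR k + 1 + w) with (x + 1) by (unfold x; ring).
    destruct (MVT_gen f x (x + 1) (fun y => (1 - p) * exp (- p * ln y))) as [xi [Hxi E]].
    - intros y Hy. rewrite Rmin_left, Rmax_right in Hy by lra.
      unfold f. auto_derive; [lra|].
      replace (- p * ln y) with ((1 - p) * ln y + - ln y) by ring.
      rewrite exp_plus, exp_Ropp, exp_ln by lra. field; lra.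
    - intros y Hy. rewrite Rmin_left, Rmax_right in Hy by lra.
      apply continuity_pt_filterlim, (ex_derive_continuous (K := R_AbsRing) (V := R_NormedModule)).
      unfold f. auto_derive. lra.
    - rewrite Rmin_left, Rmax_right in Hxi by lra.
      replace (f x - f (x + 1)) with ((p - 1) * exp (- p * ln xi)) by lra.
      rewrite <- Rmult_assoc, Rinv_l, Rmult_1_l by lra.
      apply exp_le_compat.
      assert (ln xi <= ln (x + 1)).
      { destruct (proj2 Hxi) as [Hlt| ->]; [left; apply ln_increasing; lra|right; reflexivity]. }
      nra. }
  apply (ex_series_incr_1 (fun k => exp (- p * ln (INR k + w)))).
  apply (ex_finite_lim_seq_incr (sum_n (fun k => exp (- p * ln (INR (S k) + w)))) (/ (p - 1) * f w)).
  - intros n. rewrite sum_Sn. change plus with Rplus.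
    generalize (exp_pos (- p * ln (INR (S (S n)) + w))); lra.
  - intros n.
    assert (Hn : sum_n (fun k => exp (- p * ln (INR (S k) + w))) n <=
      / (p - 1) * (f w - f (INR (S n) + w))).
    { induction n as [|n IH].
      - rewrite sum_O. generalize (Hstep 0%nat). simpl INR. rewrite Rplus_0_l. auto.
      - rewrite sum_Sn. change plus with Rplus. generalize (Hstep (S n)). lra. }
    assert (0 < / (p - 1)) by (apply Rinv_0_lt_compat; lra).
    assert (0 < f (INR (S n) + w)) by apply exp_pos. nra.
Qed.

Lemma Series_tail_le (u m : nat -> R) (n : nat) : (forall k, Rabs (u k) <= m k) -> ex_series m ->
  Rabs (Series u - sum_n u n) <= Series m - sum_n m n.
Proof.
  intros Hu Hm.
  assert (Hau : ex_series (fun k => Rabs (u k))).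
  { apply (ex_series_le (K := R_AbsRing) (V := R_CompleteNormedModule) _ m); [|exact Hm].
    intros k. change (Rabs (Rabs (u k)) <= m k). rewrite Rabs_Rabsolu. apply Hu. }
  assert (Hus : ex_series u) by (apply ex_series_Rabs, Hau).
  rewrite (Series_incr_n u (S n)), (Series_incr_n m (S n)) by (lia || assumption).
  simpl pred. rewrite <- !sum_n_Reals.
  replace (sum_n u n + Series (fun k => u (S n + k)%nat) - sum_n u n)
    with (Series (fun k => u (S n + k)%nat)) by ring.
  replace (sum_n m n + Series (fun k => m (S n + k)%nat) - sum_n m n)
    with (Series (fun k => m (S n + k)%nat)) by ring.
  eapply Rle_trans; [apply Series_Rabs, (ex_series_incr_n (fun k => Rabs (u k))), Hau|].
  apply Series_le; [intros k; split; [apply Rabs_pos|apply Hu]|].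
  apply (ex_series_incr_n m), Hm.
Qed.

Definition Csum (q : nat -> C) (n : nat) : C := sum_n (G := C_AbelianGroup) q n.

Lemma Csum_0 (q : nat -> C) : Csum q 0 = q 0%nat.
Proof. apply sum_O. Qed.

Lemma Csum_S (q : nat -> C) (n : nat) : Csum q (S n) = (Csum q n + q (S n))%C.
Proof. apply (sum_Sn (G := C_AbelianGroup)). Qed.

Lemma Re_Im_Csum (q : nat -> C) (n : nat) :
  Re (Csum q n) = sum_n (fun k => Re (q k)) n /\ Im (Csum q n) = sum_n (fun k => Im (q k)) n.
Proof.
  induction n as [|n [IH1 IH2]].
  - rewrite Csum_0, !sum_O. split; reflexivity.
  - rewrite Csum_S, !sum_Sn, <- IH1, <- IH2. split; reflexivity.
Qed.

(** The factor 2 comes from bounding the real and imaginary tails separately. *)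
Lemma CSeries_tail_le (q : nat -> C) (m : nat -> R) (n : nat) :
  (forall k, Cmod (q k) <= m k) -> ex_series m ->
  Cmod (CSeries q - Csum q n) <= 2 * (Series m - sum_n m n).
Proof.
  intros Hq Hm. eapply Rle_trans; [apply Cmod_le_Re_Im|].
  destruct (Re_Im_Csum q n) as [E1 E2].
  change (Rabs (Series (fun k => Re (q k)) - Re (Csum q n)) +
    Rabs (Series (fun k => Im (q k)) - Im (Csum q n)) <= 2 * (Series m - sum_n m n)).
  rewrite E1, E2.
  assert (H1 := Series_tail_le (fun k => Re (q k)) m n
    (fun k => Rle_trans _ _ _ (re_le_Cmod (q k)) (Hq k)) Hm).
  assert (Him : forall k, Rabs (Im (q k)) <= m k).
  { intros k. eapply Rle_trans; [|apply Hq].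
    eapply Rle_trans; [|apply Rmax_Cmod]. apply Rmax_r. }
  assert (H2 := Series_tail_le (fun k => Im (q k)) m n Him Hm). lra.
Qed.

(** [CSeries] is a total operator and carries no convergence; this predicate does. *)
Definition is_Csum (q : nat -> C) (l : C) : Prop :=
  forall eps, 0 < eps -> exists N, forall n, (N <= n)%nat -> Cmod (Csum q n - l) < eps.

Lemma CSeries_unique (q : nat -> C) (l : C) : is_Csum q l -> CSeries q = l.
Proof.
  intros H. apply C_eq; simpl; apply is_series_unique.
  - change (is_lim_seq (sum_n (fun k => Re (q k))) (Re l)).
    apply is_lim_seq_spec; intros eps; destruct (H eps (cond_pos eps)) as [N HN].
    exists N; intros n Hn. destruct (Re_Im_Csum q n) as [<- _].
    apply (proj1 (Cmod_lt_Re_Im _ _ (HN n Hn))).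
  - change (is_lim_seq (sum_n (fun k => Im (q k))) (Im l)).
    apply is_lim_seq_spec; intros eps; destruct (H eps (cond_pos eps)) as [N HN].
    exists N; intros n Hn. destruct (Re_Im_Csum q n) as [_ <-].
    apply (proj2 (Cmod_lt_Re_Im _ _ (HN n Hn))).
Qed.

Lemma Series_remainder_small (m : nat -> R) (eps : R) : ex_series m -> 0 < eps ->
  exists N, forall n, (N <= n)%nat -> Series m - sum_n m n < eps.
Proof.
  intros Hm Heps.
  assert (H : is_lim_seq (sum_n m) (Series m)) by exact (Series_correct m Hm).
  apply is_lim_seq_spec in H. destruct (H (mkposreal eps Heps)) as [N HN].
  exists N; intros n Hn. specialize (HN n Hn). simpl in HN. apply Rabs_def2 in HN. lra.
Qed.

Lemma mellin_barnes_weight_dominated (s : R) (a B : C) : 0 < s < Re B -> - PI < Carg a < PI ->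
  exists M, dominated (fun t : R => Cpower a (- (s + Ci * t)) * CGamma (s + Ci * t)
    * CGamma (B - (s + Ci * t)))%C M.
Proof.
  intros Hs Ha.
  (* The weight is the integrand of [mellin_barnes_factor] for [c = 1], whose power of [c] is 1. *)
  destruct (half_turn_strip a (ln 1) Ha) as [S1 S2].
  destruct (gamma_line_product_dominated s B _ _ Hs S1 S2) as [M HD].
  eexists. eapply dominated_ext; [|apply (dominated_scal (Cexp (B * half_turn a)) _ _ HD)].
  intros t. simpl. rewrite <- mellin_barnes_factor.
  - rewrite ln_1.
    replace (- ((B - (s + Ci * t)) * 0))%C with (RtoC 0) by ring. rewrite Cexp_0. ring.
  - lra.
  - exact Ha.
  - rewrite Re_line; lra.
  - rewrite Re_minus_line; lra.
Qed.

Lemma Ccont_Csum (q : nat -> R -> C) (n : nat) : (forall k, Ccont (q k)) ->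
  Ccont (fun t => Csum (fun k => q k t) n).
Proof.
  intros H. induction n as [|n IH].
  - apply (Ccont_ext (q 0%nat)); [intros; symmetry; apply Csum_0|apply H].
  - apply (Ccont_ext (fun t => Csum (fun k => q k t) n + q (S n) t)%C).
    + intros; symmetry; apply Csum_S.
    + apply Ccont_plus; [exact IH|apply H].
Qed.

Lemma is_CInt_line_Csum (f : nat -> R -> C) (l : nat -> C) (n : nat) :
  (forall k, is_CInt_line (f k) (l k)) ->
  is_CInt_line (fun t => Csum (fun k => f k t) n) (Csum l n).
Proof.
  intros H. induction n as [|n IH].
  - rewrite Csum_0. apply (is_CInt_line_ext (f 0%nat)); [intros; symmetry; apply Csum_0|apply H].
  - rewrite Csum_S. apply (is_CInt_line_ext (fun t => Csum (fun k => f k t) n + f (S n) t)%C).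
    + intros; symmetry; apply Csum_S.
    + apply is_CInt_line_plus; [exact IH|apply H].
Qed.

Lemma Csum_scal (c : C) (q : nat -> C) (n : nat) :
  Csum (fun k => c * q k)%C n = (c * Csum q n)%C.
Proof.
  induction n as [|n IH]; [rewrite !Csum_0; reflexivity|].
  rewrite !Csum_S, IH. ring.
Qed.

(** The majorants [m] do not depend on [t], so the series converges uniformly; multiplied by a
    dominated weight, its remainders have integrals tending to 0. *)
Lemma CInt_line_series (G : R -> C) (M : R) (q : nat -> R -> C) (m : nat -> R) :
  dominated G M -> (forall k, Ccont (q k)) -> (forall k t, Cmod (q k t) <= m k) -> ex_series m ->
  Ccont (fun t => G t * CSeries (fun k => q k t))%C /\
  exists l, is_CInt_line (fun t => G t * CSeries (fun k => q k t))%C l /\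
    is_Csum (fun k => CInt_line (fun t => G t * q k t)%C) l.
Proof.
  intros HG Hq Hb Hm. assert (HPI := PI_RGT_0). assert (HM := dominated_pos _ _ HG).
  set (Z := fun t => CSeries (fun k => q k t)).
  assert (Htail : forall n t, Cmod (Z t - Csum (fun k => q k t) n) <= 2 * (Series m - sum_n m n)).
  { intros n t. apply (CSeries_tail_le (fun k => q k t) m n); [intros k; apply Hb|exact Hm]. }
  assert (HZ : Ccont Z).
  { apply Ccont_uniform_limit. intros eps Heps.
    destruct (Series_remainder_small m (eps / 2) Hm ltac:(lra)) as [N HN].
    specialize (HN N (Nat.le_refl N)).
    exists (fun t => Csum (fun k => q k t) N). split; [apply Ccont_Csum, Hq|].
    intros t. generalize (Htail N t). lra. }
  assert (HDn : forall n, dominated (fun t => G t * (Z t - Csum (fun k => q k t) n))%C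
    (M * (2 * (Series m - sum_n m n)))).
  { intros n. apply dominated_mult_bounded; [exact HG| |apply Htail].
    apply Ccont_minus; [exact HZ|apply Ccont_Csum, Hq]. }
  assert (Hk : forall k, is_CInt_line (fun t => G t * q k t)%C (CInt_line (fun t => G t * q k t)%C)).
  { intros k. apply dominated_correct with (M * m k).
    apply dominated_mult_bounded; [exact HG|apply Hq|apply Hb]. }
  assert (Hsum : forall n, is_CInt_line (fun t => G t * Csum (fun k => q k t) n)%C
    (Csum (fun k => CInt_line (fun t => G t * q k t)%C) n)).
  { intros n. apply (is_CInt_line_ext (fun t => Csum (fun k => G t * q k t)%C n)).
    - intros t. apply Csum_scal.
    - apply is_CInt_line_Csum, Hk. }
  assert (HI : is_CInt_line (fun t => G t * Z t)%C (CInt_line (fun t => G t * Z t)%C)).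
  (* The available bounds concern remainders, so convergence of the integral comes from splitting
     off the term of index 0. *)
  { assert (H := is_CInt_line_plus _ _ _ _ (dominated_correct _ _ (HDn 0%nat)) (Hsum 0%nat)).
    assert (H' : is_CInt_line (fun t => G t * Z t)%C
      (CInt_line (fun t => G t * (Z t - Csum (fun k => q k t) 0)) +
        Csum (fun k => CInt_line (fun t => G t * q k t)) 0)%C).
    { eapply is_CInt_line_ext; [|exact H]. intros t; simpl. ring. }
    rewrite (is_CInt_line_unique _ _ H'). exact H'. }
  split; [apply Ccont_mult; [apply HG|exact HZ]|].
  exists (CInt_line (fun t => G t * Z t)%C). split; [exact HI|]. intros eps Heps.
  set (C0 := M * 2 * PI + 1).
  assert (HC0 : 0 < C0) by (unfold C0; assert (0 <= M * 2 * PI) by (apply Rmult_le_pos; lra); lra).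
  destruct (Series_remainder_small m (eps / C0) Hm ltac:(apply Rdiv_lt_0_compat; lra)) as [N HN].
  exists N. intros n Hn. specialize (HN n Hn).
  assert (Hd : is_CInt_line (fun t => G t * (Z t - Csum (fun k => q k t) n))%C
    (CInt_line (fun t => G t * Z t)%C - Csum (fun k => CInt_line (fun t => G t * q k t)%C) n)%C).
  { eapply is_CInt_line_ext; [|exact (is_CInt_line_minus _ _ _ _ HI (Hsum n))].
    intros t; simpl; ring. }
  assert (Hle := dominated_le _ _ _ (HDn n) Hd).
  rewrite <- Cmod_opp, Copp_minus_distr.
  eapply Rle_lt_trans; [exact Hle|].
  assert (Hr0 : 0 <= Series m - sum_n m n).
  { generalize (Cmod_ge_0 (Z 0 - Csum (fun k => q k 0) n)), (Htail n 0). lra. }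
  apply Rle_lt_trans with ((C0 - 1) * (Series m - sum_n m n)); [unfold C0; right; ring|].
  apply Rlt_le_trans with (C0 * (eps / C0)).
  - nra.
  - right; field; lra.
Qed.

(** * The Mellin-Barnes integral of the Hurwitz zeta function *)

Lemma CSeries_ext (q r : nat -> C) : (forall k, q k = r k) -> CSeries q = CSeries r.
Proof.
  intros H. unfold CSeries. f_equal; apply Series_ext; intros; rewrite H; reflexivity.
Qed.

Lemma is_Csum_scal (c : C) (q : nat -> C) (l : C) :
  is_Csum q l -> is_Csum (fun k => c * q k)%C (c * l)%C.
Proof.
  intros H eps Heps. assert (Hc := Cmod_ge_0 c).
  destruct (H (eps / (Cmod c + 1))) as [N HN]; [apply Rdiv_lt_0_compat; lra|].
  exists N. intros n Hn. specialize (HN n Hn).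
  rewrite Csum_scal. replace (c * Csum q n - c * l)%C with (c * (Csum q n - l))%C by ring.
  rewrite Cmod_mult.
  apply Rle_lt_trans with (Cmod c * (eps / (Cmod c + 1))).
  - apply Rmult_le_compat_l; lra.
  - apply mult_div_add1_lt; assumption.
Qed.

Lemma inv_Cpower (z s : C) : (1 / Cpower z s)%C = Cexp (- (s * Clog z)).
Proof. unfold Cpower. rewrite Cexp_opp. apply Cmult_1_l. Qed.

Theorem corollary5 (w : R) (b : C) (sigma : R) (a : C)
  (hw : 0 < w)
  (hsigma : 0 < sigma < Re b)
  (ha0 : a <> RtoC 0)
  (harg : - PI < Carg a < PI) :
  ex_vertical_integral (mellin_barnes_integrand a b w) sigma /\
  (1 / (2 * RtoC PI * Ci * CGamma (b + 1))
     * vertical_integral (mellin_barnes_integrand a b w) sigma)%C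
  = hurwitz_zeta (b + 1)%C (a + RtoC (w + 1 / 2))%C.
Proof.
  set (B := (b + 1)%C).
  assert (HB : Re B = Re b + 1) by reflexivity.
  assert (HsB : 0 < sigma < Re B) by lra.
  assert (HGam : CGamma B <> 0).
  { rewrite CGamma_gamma_line by lra. apply gamma_line_neq_0; lra. }
  assert (HPI : RtoC PI <> 0) by (intros E; apply RtoC_inj in E; generalize PI_RGT_0; lra).
  assert (HCi : Ci <> 0) by (intros E; apply (f_equal Im) in E; simpl in E; lra).
  set (x := fun k : nat => INR k + (w + 1 / 2)).
  assert (Hx : forall k, 0 < x k) by (intros k; unfold x; generalize (pos_INR k); lra).
  destruct (mellin_barnes_weight_dominated sigma a B HsB harg) as [M HG].
  destruct (CInt_line_series _ M
    (fun k (t : R) => Cexp (- ((B - (sigma + Ci * t)) * ln (x k))))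
    (fun k => exp (- (Re B - sigma) * ln (x k))) HG) as [Hcont [l [Hl Hsum]]].
  - intros k. apply Ccont_Cexp, Ccont_opp, Ccont_mult; [|apply Ccont_const].
    apply Ccont_minus; [apply Ccont_const|].
    apply Ccont_plus; [apply Ccont_const|].
    apply Ccont_mult; [apply Ccont_const|apply Ccont_id].
  - intros k t. rewrite Cmod_Cexp. right; f_equal. simpl; unfold Re, Im; ring.
  (* Here [sigma < Re b] enters: the exponent [Re B - sigma] exceeds 1. *)
  - apply exp_ln_series; lra.
  - assert (Hint : forall t : R, (Ci * (Cpower a (- (sigma + Ci * t)) * CGamma (sigma + Ci * t)
      * CGamma (B - (sigma + Ci * t)) *
      CSeries (fun k => Cexp (- ((B - (sigma + Ci * t)) * ln (x k))))))%C =
      (mellin_barnes_integrand a b w (sigma, t) * Ci)%C).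
    { intros t. unfold mellin_barnes_integrand. fold B.
      replace ((sigma, t) : C) with (sigma + Ci * t)%C by (apply C_eq; simpl; ring).
      rewrite Cmult_comm. f_equal. f_equal.
      unfold hurwitz_zeta. apply CSeries_ext. intros k.
      rewrite inv_Cpower, <- RtoC_plus. fold (x k). rewrite Clog_pos by apply Hx. reflexivity. }
    assert (HI : is_CInt_line (fun t => mellin_barnes_integrand a b w (sigma, t) * Ci)%C (Ci * l)%C).
    { eapply is_CInt_line_ext; [exact Hint|]. apply is_CInt_line_scal; [exact Hcont|exact Hl]. }
    split; [exists (Ci * l)%C; exact HI|].
    change (vertical_integral (mellin_barnes_integrand a b w) sigma)
      with (CInt_line (fun t => mellin_barnes_integrand a b w (sigma, t) * Ci)%C).
    rewrite (is_CInt_line_unique _ _ HI).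
    symmetry. unfold hurwitz_zeta.
    (* The [Ci] of [dv = i dt] cancels the one in [2 pi i]. *)
    replace (1 / (2 * RtoC PI * Ci * CGamma B) * (Ci * l))%C
      with (/ (RtoC (2 * PI) * CGamma B) * l)%C
      by (rewrite RtoC_mult; field; repeat split; assumption).
    (* The normalised integral becomes a series of normalised integrals, one for each [x k], and
       [mellin_barnes_power] evaluates each as a term of the zeta series at [a + w + 1/2]. *)
    rewrite <- (CSeries_unique _ _ (is_Csum_scal (/ (RtoC (2 * PI) * CGamma B)) _ _ Hsum)).
    apply CSeries_ext. intros k.
    rewrite mellin_barnes_power by (try exact HsB; try apply Hx; assumption).
    rewrite inv_Cpower.
    replace (INR k + (a + RtoC (w + 1 / 2)))%C with (a + RtoC (x k))%C
      by (unfold x; rewrite (RtoC_plus (INR k)); ring).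
    rewrite RtoC_mult. field. split; assumption.
Qed.
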